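(* Let $\mathbb{K}$ be a field of characteristic $0$. The set $Obj(\mathbf{Sym}_0(2,t))$ is empty if $t=2,4$. For $t=3,5$: (i) The objects in $\mathbf{Sym}_0(2,3)$ are the invariant forms $B_{2,3}^{A;\gamma}$ given by any $2\times2$ symmetric matrix $A$ and any $0\neq\gamma\in\mathbb{K}$. Moreover, $B_{2,3}^{A_1;\gamma}$ and $B_{2,3}^{A_2;\delta}$ (with $A_1,A_2$ symmetric and $\gamma,\delta\neq0$) are isomorphic in $\mathbf{Sym}_0(2,3)$ if and only if $\frac{\delta}{\gamma}\in\mathbb{K}^2=\{k^2:k\in\mathbb{K}\}$. (ii) The objects in $\mathbf{Sym}_0(2,5)$ are the invariant forms $B_{2,5}^{A_1;\gamma;A_2}$ for any $\gamma\in\mathbb{K}$ and any $2\times2$ symmetric matrices $A_1$ and $A_2$ with $\mathrm{rank}\,A_2\geq1$. Moreover, two such objects $B_{2,5}^{A_1;\gamma;A_2}$ and $B_{2,5}^{B_1;\delta;B_2}$ are isomorphic in $\mathbf{Sym}_0(2,5)$ if and only if $B_2=(\det P)^2P^tA_2P$ for some $2\times2$ regular (invertible) matrix $P$.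
   Context: For a Lie algebra $\mathfrak{n}$ put $\mathfrak{n}^1=\mathfrak{n}$, $\mathfrak{n}^i=[\mathfrak{n}^{i-1},\mathfrak{n}]$. $\mathfrak{n}_{d,t}=\mathfrak{FL}(d)/\mathfrak{FL}(d)^{t+1}$ is the free $t$-nilpotent Lie algebra over $\mathbb{K}$ on $d$ generators ($\mathfrak{FL}(d)$ the free Lie algebra). A bilinear form is invariant if $B([x,y],z)=B(x,[y,z])$. $\mathrm{Ker}(B)=\{x : B(x,y)=0\ \forall y\}$. $\mathbf{Sym}_0(d,t)$ is the category whose objects are the invariant symmetric bilinear forms $B$ on $\mathfrak{n}_{d,t}$ with $\mathrm{Ker}(B)\subseteq \mathfrak{n}_{d,t}^2$ and $\mathfrak{n}_{d,t}^t\nsubseteq \mathrm{Ker}(B)$. For objects $B_1,B_2$ let $MEnd_\perp(B_1,B_2)$ be the set of Lie algebra endomorphisms $\varphi$ of $\mathfrak{n}_{d,t}$ such that $B_1(x,y)=B_2(\varphi(x),\varphi(y))$ for all $x,y$ and $\varphi(\mathrm{Ker}(B_1))\subseteq \mathrm{Ker}(B_2)$. Then $Hom(B_1,B_2)=MEnd_\perp(B_1,B_2)/\sim$, where $\varphi_1\sim\varphi_2$ iff $(\varphi_1-\varphi_2)(\mathfrak{n}_{d,t})\subseteq \mathrm{Ker}(B_2)$; composition is induced by composition of endomorphisms. Let $x_1,x_2$ be the free generators and put $h_1=x_1$, $h_2=x_2$, $h_3=[x_2,x_1]$, $h_4=[h_3,x_1]$, $h_5=[h_3,x_2]$, $h_6=[h_4,x_1]$,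 $h_7=[h_4,x_2]$, $h_8=[h_5,x_2]$, $h_9=[h_6,x_1]$, $h_{10}=[h_6,x_2]$, $h_{11}=[h_4,h_3]$, $h_{12}=[h_7,x_2]$, $h_{13}=[h_5,h_3]$, $h_{14}=[h_8,x_2]$. Then $(h_1,\dots,h_5)$ is the Hall basis of $\mathfrak{n}_{2,3}$ and $(h_1,\dots,h_{14})$ that of $\mathfrak{n}_{2,5}$. For $A=\begin{pmatrix}\alpha&\beta\\ \beta&\delta'\end{pmatrix}$ and $\gamma\in\mathbb{K}$, $B=B_{2,3}^{A;\gamma}$ is the symmetric bilinear form on $\mathfrak{n}_{2,3}$ with $B(h_1,h_1)=\alpha$, $B(h_1,h_2)=\beta$, $B(h_2,h_2)=\delta'$, $B(h_1,h_5)=\gamma$, $B(h_2,h_4)=-\gamma$, $B(h_3,h_3)=\gamma$, all other values on pairs of basis vectors (up to symmetry) being $0$. For $A_1=\begin{pmatrix}\alpha&\beta\\ \beta&\delta'\end{pmatrix}$, $A_2=\begin{pmatrix}d&e\\ e&f\end{pmatrix}$, $\gamma\in\mathbb{K}$, $B=B_{2,5}^{A_1;\gamma;A_2}$ is the symmetric bilinear form on $\mathfrak{n}_{2,5}$ with the values just listed (for $A=A_1$) on pairs from those positions, together with $B(h_4,h_4)=d$, $B(h_4,h_5)=e$, $B(h_5,h_5)=f$; $B(h_3,h_6)=-d$, $B(h_3,h_7)=-e$, $B(h_3,h_8)=-f$; $(B(h_1,h_j))_{j=9}^{14}=(0,-d,d,-e,e,-f)$; $(B(h_2,h_j))_{j=9}^{14}=(d,0,e,0,f,0)$;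 all other values on pairs of basis vectors (up to symmetry) being $0$. *)

(* Defs.v *)
From HB Require Import structures.
From mathcomp Require Import all_boot all_algebra.
From mathcomp Require Import boolp classical_sets.

Set Implicit Arguments.
Unset Strict Implicit.
Unset Printing Implicit Defensive.

Import GRing.Theory.

Local Open Scope ring_scope.
Local Open Scope classical_set_scope.
Local Open Scope quotient_scope.

HB.mixin Record Lmodule_isLieAlgebra (K : fieldType) L of GRing.Lmodule K L := {
  lie : L -> L -> L;
  lieDl : forall x y z : L, lie (x + y) z = lie x z + lie y z;
  lieDr : forall x y z : L, lie x (y + z) = lie x y + lie x z;
  lieZl : forall (a : K) (x y : L), lie (a *: x) y = a *: lie x y;
  lieZr : forall (a : K) (x y : L), lie x (a *: y) = a *: lie x y;
  liexx : forall x : L, lie x x = 0;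
  jacobi : forall x y z : L,
    lie x (lie y z) + lie y (lie z x) + lie z (lie x y) = 0
}.

#[short(type="lieAlgType")]
HB.structure Definition LieAlgebra (K : fieldType) :=
  {L of GRing.Lmodule K L & Lmodule_isLieAlgebra K L}.

Section LieTheory.
Variables (K : fieldType) (L : lieAlgType K).

Lemma lie0l (y : L) : lie 0 y = 0.
Proof. by rewrite -[X in lie X _](scale0r 0) lieZl scale0r. Qed.

Lemma lie0r (x : L) : lie x 0 = 0.
Proof. by rewrite -[X in lie _ X](scale0r 0) lieZr scale0r. Qed.

Lemma lieBl (x y z : L) : lie (x - y) z = lie x z - lie y z.
Proof. by rewrite -scaleN1r lieDl lieZl scaleN1r. Qed.

Lemma lieBr (x y z : L) : lie x (y - z) = lie x y - lie x z.
Proof. by rewrite -scaleN1r lieDr lieZr scaleN1r. Qed.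

Lemma lieC (x y : L) : lie x y = - lie y x.
Proof.
apply/eqP; rewrite -addr_eq0; apply/eqP.
by have := liexx (x + y); rewrite lieDl !lieDr !liexx add0r addr0.
Qed.

Inductive bracket_span (A B : set L) : set L :=
| bracket_span0 : bracket_span A B 0
| bracket_span_cons (c : K) (a b z : L) :
    A a -> B b -> bracket_span A B z ->
    bracket_span A B (c *: lie a b + z).

(* [lcs 1 = L] and [lcs i.+1 = [lcs i, L]] for [0 < i]; [lcs 0] is junk. *)
Definition lcs (i : nat) : set L :=
  iter i.-1 (fun A => bracket_span A setT) setT.

Lemma bracket_spanD (A B : set L) x y :
  bracket_span A B x -> bracket_span A B y -> bracket_span A B (x + y).
Proof.
move=> + By; elim=> [|c a b z Aa Bb _ IH]; first by rewrite add0r.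
by rewrite -addrA; apply: bracket_span_cons.
Qed.

Lemma bracket_spanZ (A B : set L) k x :
  bracket_span A B x -> bracket_span A B (k *: x).
Proof.
elim=> [|c a b z Aa Bb _ IH]; first by rewrite scaler0; constructor.
by rewrite scalerDr scalerA; apply: bracket_span_cons.
Qed.

Lemma bracket_span_lie (A B : set L) a b :
  A a -> B b -> bracket_span A B (lie a b).
Proof.
move=> Aa Bb; rewrite -[lie a b]addr0 -[lie a b]scale1r.
by apply: bracket_span_cons => //; constructor.
Qed.

Lemma bracket_spanS (A A' B : set L) :
  A `<=` A' -> bracket_span A B `<=` bracket_span A' B.
Proof.
move=> sAA' x; elim=> [|c a b z Aa Bb _ IH]; first by constructor.
by apply: bracket_span_cons => //; apply: sAA'.
Qed.

Lemma lcs0 i : lcs i 0.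
Proof. by case: i => [|[|i]] //; constructor. Qed.

Lemma lcsD i x y : lcs i x -> lcs i y -> lcs i (x + y).
Proof. by case: i => [|[|i]] //; apply: bracket_spanD. Qed.

Lemma lcsZ i k x : lcs i x -> lcs i (k *: x).
Proof. by case: i => [|[|i]] //; apply: bracket_spanZ. Qed.

Lemma lcsS i : lcs i.+1 `<=` lcs i.
Proof.
case: i => // i; elim: i => [|i IH] //.
exact: (@bracket_spanS (lcs i.+2) (lcs i.+1)).
Qed.

Lemma lcs_liel i x y : lcs i x -> lcs i (lie x y).
Proof.
case: i => // i lx; apply: lcsS.
exact: (@bracket_span_lie (lcs i.+1)).
Qed.

End LieTheory.

Arguments lcs {K} L i.

HB.mixin Record isLieStable (K : fieldType) (L : lieAlgType K) (S : L -> bool)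
  := {
  scale_stable : forall (a : K) (x : L), S x -> S (a *: x);
  lie_stable : forall x y : L, S x -> S (lie x y)
}.

#[short(type="lieIdeal")]
HB.structure Definition LieIdeal (K : fieldType) (L : lieAlgType K) :=
  {S of isLieStable K L S & GRing.ZmodClosed L S}.

Definition lie_quot (K : fieldType) (L : lieAlgType K) (I : lieIdeal L) :=
  Quotient.quot I.

Section LieQuotient.
Variables (K : fieldType) (L : lieAlgType K) (I : lieIdeal L).
Local Notation Q := (lie_quot I).

HB.instance Definition _ := GRing.Zmodule.on Q.

Definition lie_proj (x : L) : Q := \pi_(Quotient.quot I) x.
Definition lie_lift (x : Q) : L := repr (x : Quotient.quot I).

Lemma lie_liftK : cancel lie_lift lie_proj.
Proof. by move=> x; exact: reprK. Qed.

Lemma lie_projW (P : Q -> Prop) : (forall x, P (lie_proj x)) -> forall x, P x.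
Proof. by move=> Pp x; rewrite -[x]lie_liftK. Qed.

Lemma lie_projP (x y : L) : reflect (lie_proj x = lie_proj y) (x - y \in I).
Proof. by rewrite (Quotient.idealrBE I x y); apply: eqP. Qed.

Lemma lie_projD (x y : L) : lie_proj (x + y) = lie_proj x + lie_proj y.
Proof. exact: (@Quotient.pi_add L I x y). Qed.

Lemma lie_proj0 : lie_proj 0 = 0.
Proof. by apply: (addIr (lie_proj 0)); rewrite -lie_projD !add0r. Qed.

Lemma lie_lift_proj (x : L) : lie_lift (lie_proj x) - x \in I.
Proof. by apply/lie_projP; rewrite lie_liftK. Qed.

Lemma scale_stableE a (x : L) : x \in I -> a *: x \in I.
Proof. exact: scale_stable. Qed.

Lemma lie_stableE (x y : L) : x \in I -> lie x y \in I.
Proof. exact: lie_stable. Qed.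

Lemma lie_stabler (x y : L) : y \in I -> lie x y \in I.
Proof. by move=> Iy; rewrite lieC rpredN lie_stableE. Qed.

Definition quot_scale (a : K) (x : Q) : Q := lie_proj (a *: lie_lift x).
Definition quot_lie (x y : Q) : Q := lie_proj (lie (lie_lift x) (lie_lift y)).

Lemma quot_scaleE a (x : L) : quot_scale a (lie_proj x) = lie_proj (a *: x).
Proof.
apply/lie_projP; rewrite -scalerBr.
by apply: scale_stableE; apply: lie_lift_proj.
Qed.

Lemma quot_lieE (x y : L) :
  quot_lie (lie_proj x) (lie_proj y) = lie_proj (lie x y).
Proof.
apply/lie_projP; set x' := lie_lift _; set y' := lie_lift _.
rewrite -[lie x' y'](subrK (lie x y')) -lieBl -addrA -lieBr.
by apply: rpredD; [apply: lie_stableE | apply: lie_stabler];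
  apply: lie_lift_proj.
Qed.

Fact quot_scalerA a b (x : Q) :
  quot_scale a (quot_scale b x) = quot_scale (a * b) x.
Proof. by elim/lie_projW: x => x; rewrite !quot_scaleE scalerA. Qed.
Fact quot_scale1r : left_id 1 quot_scale.
Proof. by elim/lie_projW=> x; rewrite quot_scaleE scale1r. Qed.
Fact quot_scalerDr : right_distributive quot_scale +%R.
Proof.
move=> a; elim/lie_projW=> x; elim/lie_projW=> y.
by rewrite -lie_projD !quot_scaleE scalerDr lie_projD.
Qed.
Fact quot_scalerDl (x : Q) :
  {morph quot_scale^~ x : a b / a + b >-> a + b}.
Proof.
by elim/lie_projW: x => x a b /=; rewrite !quot_scaleE scalerDl lie_projD.
Qed.

HB.instance Definition _ := GRing.Zmodule_isLmodule.Build K Q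
  quot_scalerA quot_scale1r quot_scalerDr quot_scalerDl.

Lemma lie_projZ a (x : L) : lie_proj (a *: x) = a *: lie_proj x.
Proof. by rewrite -quot_scaleE. Qed.

Fact quot_lieDl (x y z : Q) :
  quot_lie (x + y) z = quot_lie x z + quot_lie y z.
Proof.
elim/lie_projW: x => x; elim/lie_projW: y => y; elim/lie_projW: z => z.
by rewrite -lie_projD !quot_lieE lieDl lie_projD.
Qed.
Fact quot_lieDr (x y z : Q) :
  quot_lie x (y + z) = quot_lie x y + quot_lie x z.
Proof.
elim/lie_projW: x => x; elim/lie_projW: y => y; elim/lie_projW: z => z.
by rewrite -lie_projD !quot_lieE lieDr lie_projD.
Qed.
Fact quot_lieZl a (x y : Q) : quot_lie (a *: x) y = a *: quot_lie x y.
Proof.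
elim/lie_projW: x => x; elim/lie_projW: y => y.
by rewrite -lie_projZ !quot_lieE lieZl lie_projZ.
Qed.
Fact quot_lieZr a (x y : Q) : quot_lie x (a *: y) = a *: quot_lie x y.
Proof.
elim/lie_projW: x => x; elim/lie_projW: y => y.
by rewrite -lie_projZ !quot_lieE lieZr lie_projZ.
Qed.
Fact quot_liexx (x : Q) : quot_lie x x = 0.
Proof. by elim/lie_projW: x => x; rewrite quot_lieE liexx lie_proj0. Qed.
Fact quot_jacobi (x y z : Q) :
  quot_lie x (quot_lie y z) + quot_lie y (quot_lie z x) +
  quot_lie z (quot_lie x y) = 0.
Proof.
elim/lie_projW: x => x; elim/lie_projW: y => y; elim/lie_projW: z => z.
by rewrite !quot_lieE -!lie_projD jacobi lie_proj0.
Qed.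

HB.instance Definition _ := Lmodule_isLieAlgebra.Build K Q
  quot_lieDl quot_lieDr quot_lieZl quot_lieZr quot_liexx quot_jacobi.

Lemma lie_proj_lie (x y : L) :
  lie_proj (lie x y) = lie (lie_proj x) (lie_proj y).
Proof. by rewrite -[RHS]/(quot_lie _ _) quot_lieE. Qed.

End LieQuotient.

Inductive lie_term (K : fieldType) (d : nat) : Type :=
| LGen of 'I_d
| LZero
| LOpp of lie_term K d
| LAdd of lie_term K d & lie_term K d
| LScale of K & lie_term K d
| LBracket of lie_term K d & lie_term K d.

Arguments LGen {K d}.
Arguments LZero {K d}.

Section FreeLie.
Variables (K : fieldType) (d : nat).
Local Notation term := (lie_term K d).

HB.instance Definition _ := gen_eqMixin term.
HB.instance Definition _ := gen_choiceMixin term.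

Inductive lie_cong : term -> term -> Prop :=
| lc_refl u : lie_cong u u
| lc_sym u v : lie_cong u v -> lie_cong v u
| lc_trans u v w : lie_cong u v -> lie_cong v w -> lie_cong u w
| lc_opp u u' : lie_cong u u' -> lie_cong (LOpp u) (LOpp u')
| lc_add u u' v v' :
    lie_cong u u' -> lie_cong v v' -> lie_cong (LAdd u v) (LAdd u' v')
| lc_scale a u u' : lie_cong u u' -> lie_cong (LScale a u) (LScale a u')
| lc_bracket u u' v v' :
    lie_cong u u' -> lie_cong v v' -> lie_cong (LBracket u v) (LBracket u' v')
| lc_addA u v w : lie_cong (LAdd u (LAdd v w)) (LAdd (LAdd u v) w)
| lc_addC u v : lie_cong (LAdd u v) (LAdd v u)
| lc_add0 u : lie_cong (LAdd LZero u) u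
| lc_addN u : lie_cong (LAdd (LOpp u) u) LZero
| lc_scaleA a b u : lie_cong (LScale a (LScale b u)) (LScale (a * b) u)
| lc_scale1 u : lie_cong (LScale 1 u) u
| lc_scaleDr a u v :
    lie_cong (LScale a (LAdd u v)) (LAdd (LScale a u) (LScale a v))
| lc_scaleDl a b u :
    lie_cong (LScale (a + b) u) (LAdd (LScale a u) (LScale b u))
| lc_lieDl u v w :
    lie_cong (LBracket (LAdd u v) w) (LAdd (LBracket u w) (LBracket v w))
| lc_lieDr u v w :
    lie_cong (LBracket u (LAdd v w)) (LAdd (LBracket u v) (LBracket u w))
| lc_lieZl a u v : lie_cong (LBracket (LScale a u) v) (LScale a (LBracket u v))
| lc_lieZr a u v : lie_cong (LBracket u (LScale a v)) (LScale a (LBracket u v))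
| lc_liexx u : lie_cong (LBracket u u) LZero
| lc_jacobi u v w :
    lie_cong (LAdd (LAdd (LBracket u (LBracket v w)) (LBracket v (LBracket w u)))
                   (LBracket w (LBracket u v))) LZero.

Definition lie_congb (u v : term) : bool := `[< lie_cong u v >].

Fact lie_congb_refl : reflexive lie_congb.
Proof. by move=> u; apply/asboolP; apply: lc_refl. Qed.
Fact lie_congb_sym : symmetric lie_congb.
Proof. by move=> u v; apply/asboolP/asboolP; apply: lc_sym. Qed.
Fact lie_congb_trans : transitive lie_congb.
Proof.
by move=> v u w /asboolP uv /asboolP vw; apply/asboolP; apply: lc_trans vw.
Qed.

Canonical lie_congb_equiv :=
  EquivRel lie_congb lie_congb_refl lie_congb_sym lie_congb_trans.

Definition free_lie : Type := {eq_quot lie_congb}.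
HB.instance Definition _ := Choice.on free_lie.

Local Notation FL := free_lie.

Definition free_class (u : term) : FL := \pi_({eq_quot lie_congb}) u.
Definition free_repr (x : FL) : term := repr (x : {eq_quot lie_congb}).

Lemma free_reprK : cancel free_repr free_class.
Proof. by move=> x; exact: reprK. Qed.

Lemma free_classW (P : FL -> Prop) :
  (forall u, P (free_class u)) -> forall x, P x.
Proof. by move=> Pp x; rewrite -[x]free_reprK. Qed.

Lemma free_lieP (u v : term) : free_class u = free_class v <-> lie_cong u v.
Proof.
by split=> [/eqmodP/asboolP|uv] //; apply/eqmodP/asboolP.
Qed.

Lemma free_lie_repr (u : term) : lie_cong (free_repr (free_class u)) u.
Proof. by apply/free_lieP; rewrite free_reprK. Qed.

Definition free_zero : FL := free_class LZero.
Definition free_opp (x : FL) : FL := free_class (LOpp (free_repr x)).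
Definition free_add (x y : FL) : FL := free_class (LAdd (free_repr x) (free_repr y)).
Definition free_scale (a : K) (x : FL) : FL := free_class (LScale a (free_repr x)).
Definition free_bracket (x y : FL) : FL := free_class (LBracket (free_repr x) (free_repr y)).

Lemma free_oppE u : free_opp (free_class u) = free_class (LOpp u).
Proof. by apply/free_lieP/lc_opp/free_lie_repr. Qed.
Lemma free_addE u v : free_add (free_class u) (free_class v) = free_class (LAdd u v).
Proof. by apply/free_lieP/lc_add; apply/free_lie_repr. Qed.
Lemma free_scaleE a u : free_scale a (free_class u) = free_class (LScale a u).
Proof. by apply/free_lieP/lc_scale/free_lie_repr. Qed.
Lemma free_bracketE u v :
  free_bracket (free_class u) (free_class v) = free_class (LBracket u v).
Proof. by apply/free_lieP/lc_bracket; apply/free_lie_repr. Qed.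

Let freeE := (free_oppE, free_addE, free_scaleE, free_bracketE).

Fact free_addA : associative free_add.
Proof.
elim/free_classW=> u; elim/free_classW=> v; elim/free_classW=> w; rewrite !freeE.
exact/free_lieP/lc_addA.
Qed.
Fact free_addC : commutative free_add.
Proof.
elim/free_classW=> u; elim/free_classW=> v; rewrite !freeE.
exact/free_lieP/lc_addC.
Qed.
Fact free_add0 : left_id free_zero free_add.
Proof. by elim/free_classW=> u; rewrite !freeE; apply/free_lieP/lc_add0. Qed.
Fact free_addN : left_inverse free_zero free_opp free_add.
Proof. by elim/free_classW=> u; rewrite !freeE; apply/free_lieP/lc_addN. Qed.

HB.instance Definition _ := GRing.isZmodule.Build FL
  free_addA free_addC free_add0 free_addN.

Fact free_scaleA a b (x : FL) :
  free_scale a (free_scale b x) = free_scale (a * b) x.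
Proof. by elim/free_classW: x => u; rewrite !freeE; apply/free_lieP/lc_scaleA. Qed.
Fact free_scale1 : left_id 1 free_scale.
Proof. by elim/free_classW=> u; rewrite !freeE; apply/free_lieP/lc_scale1. Qed.
Fact free_scaleDr : right_distributive free_scale +%R.
Proof.
move=> a; elim/free_classW=> u; elim/free_classW=> v; rewrite -[+%R]/free_add !freeE.
exact/free_lieP/lc_scaleDr.
Qed.
Fact free_scaleDl (x : FL) :
  {morph free_scale^~ x : a b / a + b >-> a + b}.
Proof.
elim/free_classW: x => u a b /=; rewrite -[X in _ = X]/(free_add _ _) !freeE.
exact/free_lieP/lc_scaleDl.
Qed.

HB.instance Definition _ := GRing.Zmodule_isLmodule.Build K FL
  free_scaleA free_scale1 free_scaleDr free_scaleDl.

Fact free_lieDl (x y z : FL) :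
  free_bracket (x + y) z = free_bracket x z + free_bracket y z.
Proof.
elim/free_classW: x => u; elim/free_classW: y => v; elim/free_classW: z => w.
rewrite -[+%R]/free_add !freeE; exact/free_lieP/lc_lieDl.
Qed.
Fact free_lieDr (x y z : FL) :
  free_bracket x (y + z) = free_bracket x y + free_bracket x z.
Proof.
elim/free_classW: x => u; elim/free_classW: y => v; elim/free_classW: z => w.
rewrite -[+%R]/free_add !freeE; exact/free_lieP/lc_lieDr.
Qed.
Fact free_lieZl a (x y : FL) : free_bracket (a *: x) y = a *: free_bracket x y.
Proof.
elim/free_classW: x => u; elim/free_classW: y => v.
rewrite -[*:%R]/free_scale !freeE; exact/free_lieP/lc_lieZl.
Qed.
Fact free_lieZr a (x y : FL) : free_bracket x (a *: y) = a *: free_bracket x y.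
Proof.
elim/free_classW: x => u; elim/free_classW: y => v.
rewrite -[*:%R]/free_scale !freeE; exact/free_lieP/lc_lieZr.
Qed.
Fact free_liexx (x : FL) : free_bracket x x = 0.
Proof. by elim/free_classW: x => u; rewrite freeE; apply/free_lieP/lc_liexx. Qed.
Fact free_jacobi (x y z : FL) :
  free_bracket x (free_bracket y z) + free_bracket y (free_bracket z x) +
  free_bracket z (free_bracket x y) = 0.
Proof.
elim/free_classW: x => u; elim/free_classW: y => v; elim/free_classW: z => w.
rewrite -[+%R]/free_add !freeE; exact/free_lieP/lc_jacobi.
Qed.

HB.instance Definition _ := Lmodule_isLieAlgebra.Build K FL
  free_lieDl free_lieDr free_lieZl free_lieZr free_liexx free_jacobi.

Lemma free_class0 : free_class LZero = 0.
Proof. by []. Qed.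
Lemma free_classN u : free_class (LOpp u) = - free_class u.
Proof. by rewrite -free_oppE. Qed.
Lemma free_classD u v : free_class (LAdd u v) = free_class u + free_class v.
Proof. by rewrite -free_addE. Qed.
Lemma free_classZ a u : free_class (LScale a u) = a *: free_class u.
Proof. by rewrite -free_scaleE. Qed.
Lemma free_class_lie u v :
  free_class (LBracket u v) = lie (free_class u) (free_class v).
Proof. by rewrite -free_bracketE. Qed.

Definition free_gen (i : 'I_d) : FL := free_class (LGen i).

Lemma free_lie_universal (L : lieAlgType K) (g : 'I_d -> L) :
  exists f : {linear FL -> L},
    [/\ forall i, f (free_gen i) = g i,
        {morph f : x y / lie x y >-> lie x y}
      & forall f' : {linear FL -> L}, (forall i, f' (free_gen i) = g i) ->
          {morph f' : x y / lie x y >-> lie x y} -> f' =1 f].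
Proof.
pose ev := fix ev (u : term) : L := match u with
  | LGen i => g i
  | LZero => 0
  | LOpp u => - ev u
  | LAdd u v => ev u + ev v
  | LScale a u => a *: ev u
  | LBracket u v => lie (ev u) (ev v)
  end.
have evP u v : lie_cong u v -> ev u = ev v.
  by elim=> //= *; rewrite ?(addrA, add0r, addNr, scalerA, scale1r, scalerDr,
    scalerDl, lieDl, lieDr, lieZl, lieZr, liexx, jacobi) //;
    solve [congruence | exact: addrC].
pose f (x : FL) := ev (free_repr x).
have fE u : f (free_class u) = ev u by apply/evP/free_lie_repr.
have f_lin : linear f.
  move=> a; elim/free_classW=> u; elim/free_classW=> v.
  by rewrite -[*:%R]/free_scale -[+%R]/free_add !freeE !fE.
pose F : {linear FL -> L} :=
  HB.pack_for {linear FL -> L} f (GRing.isLinear.Build K FL L *:%R f f_lin).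
exists F; split=> [i|x y|f' f'g f'l].
- exact: fE.
- elim/free_classW: x => u; elim/free_classW: y => v.
  by rewrite /= -free_class_lie !fE.
- elim/free_classW=> u; rewrite /= fE.
  elim: u => [i||u IH|u IHu v IHv|a u IH|u IHu v IHv] /=.
  + exact: f'g.
  + by rewrite free_class0 raddf0.
  + by rewrite free_classN raddfN; congr (- _).
  + by rewrite free_classD raddfD; congr (_ + _).
  + by rewrite free_classZ linearZ; congr (_ *: _).
  + by rewrite free_class_lie f'l; congr (lie _ _).
Qed.

End FreeLie.

Section LcsIdeal.
Variables (K : fieldType) (L : lieAlgType K) (i : nat).

Definition lcsb (x : L) : bool := `[< lcs L i x >].

Fact lcsb_zmod : zmod_closed lcsb.
Proof.
split=> [|x y]; rewrite -!topredE /=; first exact/asboolP/lcs0.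
move=> /asboolP lx /asboolP ly; apply/asboolP/lcsD=> //.
by rewrite -scaleN1r; apply: lcsZ.
Qed.
HB.instance Definition _ := GRing.isZmodClosed.Build L lcsb lcsb_zmod.

Fact lcsb_scale (a : K) (x : L) : lcsb x -> lcsb (a *: x).
Proof. by move=> /asboolP lx; apply/asboolP/lcsZ. Qed.
Fact lcsb_lie (x y : L) : lcsb x -> lcsb (lie x y).
Proof. by move=> /asboolP lx; apply/asboolP/lcs_liel. Qed.
HB.instance Definition _ := isLieStable.Build K L lcsb lcsb_scale lcsb_lie.

End LcsIdeal.

Definition free_nil (K : fieldType) (d t : nat) : lieAlgType K :=
  lie_quot (@lcsb K (free_lie K d) t.+1 : lieIdeal (free_lie K d)).

Definition nil_gen (K : fieldType) (d t : nat) (i : 'I_d) : free_nil K d t :=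
  lie_proj (@lcsb K (free_lie K d) t.+1) (free_gen K i).

Section Forms.
Variables (K : fieldType) (L : lieAlgType K).
Implicit Type B : L -> L -> K.

Definition bilinear_form B : Prop :=
  (forall y, scalar (B^~ y)) /\ (forall x, scalar (B x)).

Definition symmetric_form B : Prop := forall x y, B x y = B y x.

Definition invariant_form B : Prop :=
  forall x y z, B (lie x y) z = B x (lie y z).

Definition form_ker B : set L := [set x | forall y, B x y = 0].

End Forms.

Record category : Type := Category {
  obj : Type;
  hom : obj -> obj -> Type;
  idmap : forall a, hom a a;
  comp : forall a b c, hom b c -> hom a b -> hom a c;
  comp_idl : forall a b (f : hom a b), comp (idmap b) f = f;
  comp_idr : forall a b (f : hom a b), comp f (idmap a) = f;
  compA : forall a b c d (h : hom c d) (g : hom b c) (f : hom a b),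
    comp h (comp g f) = comp (comp h g) f
}.

Definition isomorphic (C : category) (a b : obj C) : Prop :=
  exists (f : hom a b) (g : hom b a),
    comp g f = idmap a /\ comp f g = idmap b.

Section Sym0.
Variables (K : fieldType) (d t : nat).
Local Notation n := (free_nil K d t).

Record is_sym0 (B : n -> n -> K) : Prop := IsSym0 {
  sym0_bilinear : bilinear_form B;
  sym0_symmetric : symmetric_form B;
  sym0_invariant : invariant_form B;
  sym0_ker : form_ker B `<=` lcs n 2;
  sym0_top : ~ (lcs n t `<=` form_ker B)
}.

Record sym0_obj : Type := Sym0Obj {
  sym0_form :> n -> n -> K;
  sym0_formP : is_sym0 sym0_form
}.

Record MEnd (B1 B2 : sym0_obj) : Type := MkMEnd {
  mend :> {linear n -> n};
  mend_lie : forall x y, mend (lie x y) = lie (mend x) (mend y);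
  mend_form : forall x y, B1 x y = B2 (mend x) (mend y);
  mend_ker : mend @` form_ker B1 `<=` form_ker B2
}.

HB.instance Definition _ B1 B2 := gen_eqMixin (MEnd B1 B2).
HB.instance Definition _ B1 B2 := gen_choiceMixin (MEnd B1 B2).

Definition MEnd_eq (B1 B2 : sym0_obj) (f g : MEnd B1 B2) : Prop :=
  forall x, form_ker B2 (f x - g x).

Definition MEnd_eqb B1 B2 (f g : MEnd B1 B2) : bool := `[< MEnd_eq f g >].

Lemma sym0_kerD (B : sym0_obj) x y :
  form_ker B x -> form_ker B y -> form_ker B (x + y).
Proof.
move=> kx ky z; have [Bl _] := sym0_bilinear (sym0_formP B).
by have := Bl z 1 x y; rewrite !scale1r mul1r kx ky addr0.
Qed.

Lemma sym0_kerN (B : sym0_obj) x : form_ker B x -> form_ker B (- x).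
Proof.
move=> kx z; have [Bl _] := sym0_bilinear (sym0_formP B).
have B0 : B 0 z = 0.
  have := Bl z 1 0 0; rewrite !scale1r mul1r addr0 => /eqP.
  by rewrite -subr_eq0 opprD addrA subrr sub0r oppr_eq0 => /eqP.
by have := Bl z (-1) x 0; rewrite addr0 scaleN1r kx mulr0 B0 addr0.
Qed.

Fact MEnd_eq_refl B1 B2 : reflexive (@MEnd_eqb B1 B2).
Proof.
move=> f; apply/asboolP => x; rewrite subrr -(subrr 0).
have [Bl _] := sym0_bilinear (sym0_formP B2).
move=> z; have := Bl z (-1) 0 0.
by rewrite !subrr scaler0 addr0 mulN1r addNr.
Qed.

Fact MEnd_eq_sym B1 B2 : symmetric (@MEnd_eqb B1 B2).
Proof.
by move=> f g; apply/asboolP/asboolP => fg x; rewrite -opprB; apply: sym0_kerN.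
Qed.

Fact MEnd_eq_trans B1 B2 : transitive (@MEnd_eqb B1 B2).
Proof.
move=> g f h /asboolP fg /asboolP gh; apply/asboolP => x.
by rewrite -(subrK (g x) (f x)) -addrA; apply: sym0_kerD.
Qed.

Canonical MEnd_equiv B1 B2 :=
  EquivRel (@MEnd_eqb B1 B2)
    (@MEnd_eq_refl B1 B2) (@MEnd_eq_sym B1 B2) (@MEnd_eq_trans B1 B2).

Definition sym0_hom (B1 B2 : sym0_obj) : Type := {eq_quot @MEnd_eqb B1 B2}.

Definition hom_class B1 B2 (f : MEnd B1 B2) : sym0_hom B1 B2 :=
  \pi_({eq_quot @MEnd_eqb B1 B2}) f.
Definition hom_repr B1 B2 (f : sym0_hom B1 B2) : MEnd B1 B2 :=
  repr (f : {eq_quot @MEnd_eqb B1 B2}).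

Lemma hom_reprK B1 B2 : cancel (@hom_repr B1 B2) (@hom_class B1 B2).
Proof. by move=> f; exact: reprK. Qed.

Lemma hom_classP B1 B2 (f g : MEnd B1 B2) :
  hom_class f = hom_class g <-> MEnd_eq f g.
Proof.
by split=> [/eqmodP/asboolP|fg] //; apply/eqmodP/asboolP.
Qed.

Lemma hom_classW B1 B2 (P : sym0_hom B1 B2 -> Prop) :
  (forall f, P (hom_class f)) -> forall f, P f.
Proof. by move=> Pc f; rewrite -[f]hom_reprK. Qed.

Fact MEnd_id_ker (B : sym0_obj) :
  (idfun : {linear n -> n}) @` form_ker B `<=` form_ker B.
Proof. by move=> _ [x kx <-]. Qed.

Definition MEnd_id (B : sym0_obj) : MEnd B B :=
  @MkMEnd B B (idfun : {linear n -> n})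
    (fun _ _ => erefl) (fun _ _ => erefl) (@MEnd_id_ker B).

Section Comp.
Variables (B1 B2 B3 : sym0_obj) (g : MEnd B2 B3) (f : MEnd B1 B2).
Let gf : {linear n -> n} := mend g \o mend f.

Fact MEnd_comp_lie x y : gf (lie x y) = lie (gf x) (gf y).
Proof. by rewrite /= !mend_lie. Qed.
Fact MEnd_comp_form x y : B1 x y = B3 (gf x) (gf y).
Proof. by rewrite (mend_form f) (mend_form g). Qed.
Fact MEnd_comp_ker : gf @` form_ker B1 `<=` form_ker B3.
Proof.
move=> _ [x kx <-]; rewrite -[gf x]/(mend g (mend f x)).
apply: (@mend_ker _ _ g); exists (mend f x) => //.
by apply: (@mend_ker _ _ f); exists x.
Qed.

Definition MEnd_comp : MEnd B1 B3 :=
  @MkMEnd B1 B3 gf MEnd_comp_lie MEnd_comp_form MEnd_comp_ker.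
End Comp.

Definition sym0_id (B : sym0_obj) : sym0_hom B B := hom_class (MEnd_id B).

Definition sym0_comp B1 B2 B3 (g : sym0_hom B2 B3) (f : sym0_hom B1 B2) :
  sym0_hom B1 B3 := hom_class (MEnd_comp (hom_repr g) (hom_repr f)).

Lemma sym0_compE B1 B2 B3 (g : MEnd B2 B3) (f : MEnd B1 B2) :
  sym0_comp (hom_class g) (hom_class f) = hom_class (MEnd_comp g f).
Proof.
apply/hom_classP => x /=.
set g' := hom_repr _; set f' := hom_repr _.
have /hom_classP g'g : hom_class g' = hom_class g by rewrite hom_reprK.
have /hom_classP f'f : hom_class f' = hom_class f by rewrite hom_reprK.
rewrite -(subrK (g' (f x)) (g' (f' x))) -addrA -linearB.
apply: sym0_kerD; last exact: g'g.
by apply: (@mend_ker _ _ g'); exists (f' x - f x).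
Qed.

Fact sym0_comp_idl B1 B2 (f : sym0_hom B1 B2) : sym0_comp (sym0_id B2) f = f.
Proof.
elim/hom_classW: f => f; rewrite sym0_compE; apply/hom_classP => x.
exact: (asboolP _ (MEnd_eq_refl f)).
Qed.

Fact sym0_comp_idr B1 B2 (f : sym0_hom B1 B2) : sym0_comp f (sym0_id B1) = f.
Proof.
elim/hom_classW: f => f; rewrite sym0_compE; apply/hom_classP => x.
exact: (asboolP _ (MEnd_eq_refl f)).
Qed.

Fact sym0_compA B1 B2 B3 B4 (h : sym0_hom B3 B4) (g : sym0_hom B2 B3)
    (f : sym0_hom B1 B2) :
  sym0_comp h (sym0_comp g f) = sym0_comp (sym0_comp h g) f.
Proof.
elim/hom_classW: f => f; elim/hom_classW: g => g; elim/hom_classW: h => h.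
rewrite !sym0_compE; apply/hom_classP => x.
exact: (asboolP _ (MEnd_eq_refl (MEnd_comp h (MEnd_comp g f)))).
Qed.

Definition Sym0 : category :=
  Category sym0_comp_idl sym0_comp_idr sym0_compA.

End Sym0.

Section HallBasis.
Variables (K : fieldType) (L : lieAlgType K) (x1 x2 : L).

(* [hall_seq`_i] is h_(i+1). *)
Definition hall_seq : 14.-tuple L :=
  let h1 := x1 in let h2 := x2 in let h3 := lie h2 h1 in
  let h4 := lie h3 h1 in let h5 := lie h3 h2 in
  let h6 := lie h4 h1 in let h7 := lie h4 h2 in let h8 := lie h5 h2 in
  let h9 := lie h6 h1 in let h10 := lie h6 h2 in let h11 := lie h4 h3 in
  let h12 := lie h7 h2 in let h13 := lie h5 h3 in let h14 := lie h8 h2 in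
  [tuple h1; h2; h3; h4; h5; h6; h7; h8; h9; h10; h11; h12; h13; h14].

End HallBasis.

Definition hall23 (K : fieldType) (i : 'I_5) : free_nil K 2 3 :=
  (hall_seq (nil_gen K 3 0) (nil_gen K 3 1))`_i.

Definition hall25 (K : fieldType) (i : 'I_14) : free_nil K 2 5 :=
  (hall_seq (nil_gen K 5 0) (nil_gen K 5 1))`_i.

Section GramForm.
Variables (K : fieldType) (L : lmodType K) (m : nat) (h : 'I_m -> L).

(* The coordinates in the basis [h]; junk when [h] is not a basis. *)
Definition coords (x : L) : 'rV[K]_m :=
  xget 0 [set c : 'rV[K]_m | x = \sum_i c 0 i *: h i].

Definition form_of_gram (G : 'M[K]_m) (x y : L) : K :=
  (coords x *m G *m (coords y)^T) 0 0.

End GramForm.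

Section Tables.
Variables (K : fieldType) (A1 : 'M[K]_2) (gamma : K) (A2 : 'M[K]_2).

(* Values on the pairs (h_i, h_j) with i <= j, indexed from 1. *)
Definition table23 (i j : nat) : K :=
  let alpha := A1 0 0 in let beta := A1 0 1 in let delta' := A1 1 1 in
  match i, j with
  | 1, 1 => alpha | 1, 2 => beta | 2, 2 => delta'
  | 1, 5 => gamma | 2, 4 => - gamma | 3, 3 => gamma
  | _, _ => 0%R
  end%N.

Definition table25 (i j : nat) : K :=
  let d := A2 0 0 in let e := A2 0 1 in let f := A2 1 1 in
  match i, j with
  | 4, 4 => d | 4, 5 => e | 5, 5 => f
  | 3, 6 => - d | 3, 7 => - e | 3, 8 => - f
  | 1, 10 => - d | 1, 11 => d | 1, 12 => - e | 1, 13 => e | 1, 14 => - f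
  | 2, 9 => d | 2, 11 => e | 2, 13 => f
  | _, _ => table23 i j
  end%N.

End Tables.

Definition gram_of_table (K : fieldType) (m : nat) (u : nat -> nat -> K) :
  'M[K]_m := \matrix_(i, j) u (minn i j).+1 (maxn i j).+1.

Definition B23 (K : fieldType) (A : 'M[K]_2) (gamma : K) :
    free_nil K 2 3 -> free_nil K 2 3 -> K :=
  form_of_gram (@hall23 K) (gram_of_table 5 (table23 A gamma)).

Definition B25 (K : fieldType) (A1 : 'M[K]_2) (gamma : K) (A2 : 'M[K]_2) :
    free_nil K 2 5 -> free_nil K 2 5 -> K :=
  form_of_gram (@hall25 K) (gram_of_table 14 (table25 A1 gamma A2)).

(* Main.v *)
(** Hall coordinates on [free_lie K 2] modulo the sixth term of the lower
    central series come from the explicit bracket on K^14 written down below,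
    which shows that the Hall elements are independent.

    The kernel of an invariant form is an ideal, so a form that kills both
    generators is zero.  Moving brackets across, an invariant symmetric form on
    n_{2,t} with t <= 5 is therefore determined by its values on the generators
    ([gram1]), by B(h_3,h_3) ([gram2]) and by its values on h_4, h_5 ([gram3]).
    Since B(n^i,n^j) = 0 for i + j > t + 1, [gram3] vanishes for t <= 4 and
    [gram2] for t = 2.  This yields the objects.

    Pulling back along an endomorphism with linear part P turns [gram3] into
    (det P)^2 P^t [gram3] P and, if [gram3] = 0, multiplies [gram2] by (det P)^2;
    this gives the necessary conditions.  Conversely, after a linear change of
    the generators the leading invariants agree, and a unipotent automorphism
    x_i |-> x_i + w_i with w_i in n^2 fixes [gram3] while its w_i can be tuned to
    prescribe first [gram2], then [gram1] (dividing by 2). *)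

From HB Require Import structures.
Require Import Defs.
From mathcomp Require Import all_boot all_algebra.
From mathcomp Require Import boolp classical_sets functions.
From mathcomp Require Import ring.

Set Implicit Arguments.
Unset Strict Implicit.
Unset Printing Implicit Defensive.

Import GRing.Theory.

Local Open Scope ring_scope.

(** * The Hall basis *)

Section HallModel.
Variable K : fieldType.

(* Indices are shifted by one: [x k] is the coordinate on h_(k+1), and only
   k < 14 matters. *)
Definition hall_model : Type := nat -> K^o.

HB.instance Definition _ := GRing.Lmodule.on hall_model.

Lemma hall_modelD (x y : hall_model) k : (x + y) k = x k + y k.
Proof. by []. Qed.
Lemma hall_modelN (x : hall_model) k : (- x) k = - x k.
Proof. by []. Qed.
Lemma hall_modelZ a (x : hall_model) k : (a *: x) k = a * x k.
Proof. by []. Qed.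
Lemma hall_model0 k : (0 : hall_model) k = 0.
Proof. by []. Qed.

Let hallE := (hall_modelD, hall_modelN, hall_modelZ, hall_model0).

(* The structure constants of n_{2,5}; those not read off the definition of the
   Hall elements are [h_5,h_1] = h_7, [h_7,h_1] = h_10 + h_11 and
   [h_8,h_1] = h_12 + h_13. *)
Definition hall_bracket (x y : hall_model) : hall_model :=
  let w (i j : nat) : K := x i * y j - x j * y i in
  fun k => match k with
  | 2 => w 1%N 0%N
  | 3 => w 2%N 0%N | 4 => w 2%N 1%N
  | 5 => w 3%N 0%N | 6 => w 3%N 1%N + w 4%N 0%N | 7 => w 4%N 1%N
  | 8 => w 5%N 0%N | 9 => w 5%N 1%N + w 6%N 0%N | 10 => w 6%N 0%N + w 3%N 2%N
  | 11 => w 6%N 1%N + w 7%N 0%N | 12 => w 7%N 0%N + w 4%N 2%N | 13 => w 7%N 1%N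
  | _ => 0
  end.

Ltac by_coord k :=
  apply/funext => k;
  do 14! [case: k => [|k]; first by rewrite /hall_bracket ?hallE /=; ring];
  by rewrite /hall_bracket ?hallE /=; ring.

Fact hall_bracketDl x y z :
  hall_bracket (x + y) z = hall_bracket x z + hall_bracket y z.
Proof. by_coord k. Qed.
Fact hall_bracketDr x y z :
  hall_bracket x (y + z) = hall_bracket x y + hall_bracket x z.
Proof. by_coord k. Qed.
Fact hall_bracketZl a x y : hall_bracket (a *: x) y = a *: hall_bracket x y.
Proof. by_coord k. Qed.
Fact hall_bracketZr a x y : hall_bracket x (a *: y) = a *: hall_bracket x y.
Proof. by_coord k. Qed.
Fact hall_bracketxx x : hall_bracket x x = 0.
Proof. by_coord k. Qed.
Fact hall_bracket_jacobi x y z :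
  hall_bracket x (hall_bracket y z) + hall_bracket y (hall_bracket z x) +
  hall_bracket z (hall_bracket x y) = 0.
Proof. by_coord k. Qed.

HB.instance Definition _ := Lmodule_isLieAlgebra.Build K hall_model
  hall_bracketDl hall_bracketDr hall_bracketZl hall_bracketZr
  hall_bracketxx hall_bracket_jacobi.

(** The bracket length of h_(k+1). The default 6 places every index from 14 on above the nilpotency
    class 5. *)
Definition hall_deg : nat -> nat :=
  nth 6 [:: 1; 1; 2; 3; 3; 4; 4; 4; 5; 5; 5; 5; 5; 5]%N.

(** The bracket is graded: coordinate [k] of [u,v] only involves coordinates of [u] of degree below
    [hall_deg k], so each step of the series clears one more degree. *)
Lemma hall_model_lcs i (x : hall_model) (k : nat) :
  lcs hall_model i x -> (k < 14)%N -> (hall_deg k < i)%N -> x k = 0.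
Proof.
case: i => // i; elim: i x k => [|i IH] x k; first by do 14! case: k => [|k] //.
elim=> [|a u v y Vu _ _ IHy] k14 ki //.
rewrite !hallE IHy //.
have V j : (j < 14)%N -> (hall_deg j < hall_deg k)%N -> u j = 0.
  by move=> j14 jk; apply: IH => //; apply: leq_trans jk _.
rewrite /lie /= /hall_bracket; clear IHy.
by do 14! [case: k k14 ki V => [|k] k14 ki V; first by rewrite ?V //; ring].
Qed.

Definition hall_model_gen (i : 'I_2) : hall_model := fun k => (k == i)%:R.

(** The general invariant symmetric form in Hall coordinates. Its three parameters weigh monomials
    of total degree 2, 4 and 6 respectively, which is the source of the vanishing statements
    below. *)
Definition hall_form (A1 : 'M[K]_2) (gamma : K) (A2 : 'M[K]_2)
    (x y : hall_model) : K :=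
  let s (i j : nat) : K := x i * y j + x j * y i in
  A1 0 0 * (x 0%N * y 0%N) + A1 0 1 * s 0%N 1%N + A1 1 1 * (x 1%N * y 1%N)
  + gamma * (x 2%N * y 2%N + s 0%N 4%N - s 1%N 3%N)
  + A2 0 0 * (x 3%N * y 3%N - s 2%N 5%N - s 0%N 9%N + s 0%N 10%N + s 1%N 8%N)
  + A2 0 1 * (s 3%N 4%N - s 2%N 6%N - s 0%N 11%N + s 0%N 12%N + s 1%N 10%N)
  + A2 1 1 * (x 4%N * y 4%N - s 2%N 7%N - s 0%N 13%N + s 1%N 12%N).

Lemma hall_form_inv A1 gamma A2 (x y z : hall_model) :
  hall_form A1 gamma A2 (lie x y) z = hall_form A1 gamma A2 x (lie y z).
Proof. by rewrite /hall_form /lie /= /hall_bracket /=; ring. Qed.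

End HallModel.

(** * The lower central series as a filtration *)

Section LowerCentralSeries.
Variables (K : fieldType) (L : lieAlgType K).
Implicit Types x y z : L.

Lemma lieNl x y : lie (- x) y = - lie x y.
Proof. by rewrite -scaleN1r lieZl scaleN1r. Qed.

Lemma lie_jacobir x y z : lie x (lie y z) = lie (lie x y) z - lie (lie x z) y.
Proof.
have := jacobi x y z; rewrite (lieC y (lie z x)) (lieC z (lie x y)) (lieC z x).
by rewrite lieNl opprK => /eqP; rewrite subr_eq0 => /eqP <-; rewrite addrK.
Qed.

Lemma lie_lieAC x y z : lie (lie x y) z = lie (lie x z) y + lie x (lie y z).
Proof. by rewrite lie_jacobir addrC subrK. Qed.

Lemma lie_suml (I : Type) (r : seq I) (F : I -> L) y :
  lie (\sum_(i <- r) F i) y = \sum_(i <- r) lie (F i) y.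
Proof. by elim/big_rec2: _ => [|i z x _ <-]; rewrite ?lie0l ?lieDl. Qed.

Lemma lcsN i x : lcs L i x -> lcs L i (- x).
Proof. by rewrite -scaleN1r; apply: lcsZ. Qed.

Lemma lcsB i x y : lcs L i x -> lcs L i y -> lcs L i (x - y).
Proof. by move=> lx ly; apply/lcsD/lcsN. Qed.

Lemma lcs_le i j x : (i <= j)%N -> lcs L j x -> lcs L i x.
Proof.
move=> /subnK <-; elim: (j - i)%N => // n IH lx; apply: IH; exact: lcsS.
Qed.

Lemma lcs_lieS i x y : lcs L i.+1 x -> lcs L i.+2 (lie x y).
Proof. by move=> lx; apply: (@bracket_span_lie _ _ (lcs L i.+1)). Qed.

(** Induction on [j]: Jacobi rewrites [x,[u,v]] as [[x,u],v] - [[x,v],u], and both terms have the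
    right weight. Successor indices keep clear of the junk term [lcs 0]. *)
Lemma lcs_lie i j x y :
  lcs L i.+1 x -> lcs L j.+1 y -> lcs L (i + j).+2 (lie x y).
Proof.
elim: j i x y => [|j IH] i x y lx; first by rewrite addn0 => _; apply: lcs_lieS.
elim=> [|a u v z lu _ _ IHz]; first by rewrite lie0r; apply: lcs0.
rewrite lieDr lieZr; apply: lcsD => //; apply: lcsZ; rewrite lie_jacobir addnS.
apply: lcsB; first exact/lcs_lieS/IH.
by rewrite -addSn; apply: IH => //; apply: lcs_lieS.
Qed.

End LowerCentralSeries.

Lemma lie_morph_lcs (K : fieldType) (L L' : lieAlgType K) (f : {linear L -> L'}) i x :
  {morph f : x y / lie x y >-> lie x y} -> lcs L i x -> lcs L' i (f x).
Proof.
move=> fl; case: i => // i; elim: i x => [|i IH] x //.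
elim=> [|a u v y lu _ _ IHy]; first by rewrite linear0; apply: lcs0.
by rewrite linearD linearZ fl; apply/lcsD => //; apply/lcsZ/lcs_lieS/IH.
Qed.

(** * Free nilpotent Lie algebras and their endomorphisms *)

Section FreeInduction.
Variables (K : fieldType) (d t : nat).

Lemma free_lie_ind (P : free_lie K d -> Prop) :
  (forall i, P (free_gen K i)) -> (forall x y, P x -> P y -> P (x + y)) ->
  (forall a x, P x -> P (a *: x)) -> (forall x y, P x -> P y -> P (lie x y)) ->
  P 0 -> forall x, P x.
Proof.
move=> Pg PD PZ Pl P0; elim/free_classW; elim=> //.
- by move=> u Pu; rewrite free_classN -scaleN1r; apply: PZ.
- by move=> u Pu v Pv; rewrite free_classD; apply: PD.
- by move=> a u Pu; rewrite free_classZ; apply: PZ.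
- by move=> u Pu v Pv; rewrite free_class_lie; apply: Pl.
Qed.

Definition nil_proj : free_lie K d -> free_nil K d t :=
  @lie_proj K (free_lie K d) (@lcsb K (free_lie K d) t.+1).

Definition nil_lift : free_nil K d t -> free_lie K d :=
  @lie_lift K (free_lie K d) (@lcsb K (free_lie K d) t.+1).

Fact nil_proj_linear : linear nil_proj.
Proof. by move=> a x y; rewrite /nil_proj lie_projD lie_projZ. Qed.
HB.instance Definition _ :=
  GRing.isLinear.Build K (free_lie K d) (free_nil K d t) *:%R nil_proj nil_proj_linear.

Lemma nil_proj_lie : {morph nil_proj : x y / lie x y >-> lie x y}.
Proof. by move=> x y; apply: lie_proj_lie. Qed.

Lemma nil_proj_gen i : nil_proj (free_gen K i) = nil_gen K t i.
Proof. by []. Qed.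

Lemma nil_liftK x : nil_proj (nil_lift x) = x.
Proof. exact: lie_liftK. Qed.

Lemma nil_proj_eq u v : nil_proj u = nil_proj v <-> lcs (free_lie K d) t.+1 (u - v).
Proof.
split=> [/lie_projP uv|uv]; first by move: uv; rewrite -topredE /= => /asboolP.
by apply/lie_projP; rewrite -topredE /=; apply/asboolP.
Qed.

Lemma nil_proj_eq0 u : nil_proj u = 0 <-> lcs (free_lie K d) t.+1 u.
Proof. by rewrite -(linear0 nil_proj) nil_proj_eq subr0. Qed.

Lemma nil_lcs_lift i x : lcs (free_nil K d t) i x ->
  exists2 u, lcs (free_lie K d) i u & x = nil_proj u.
Proof.
case: i => [|i]; first by exists (nil_lift x); rewrite ?nil_liftK.
elim: i x => [|i IH] x; first by exists (nil_lift x); rewrite ?nil_liftK.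
elim=> [|a u v y lu _ _ [w lw ->]]; first by exists 0; rewrite ?linear0 //; apply: lcs0.
have [u' lu' ->] := IH _ lu; exists (a *: lie u' (nil_lift v) + w).
  by apply/lcsD => //; apply/lcsZ/lcs_lieS.
by rewrite linearD linearZ /= nil_proj_lie nil_liftK.
Qed.

Lemma nil_lcs0 x : lcs (free_nil K d t) t.+1 x -> x = 0.
Proof. by move=> /nil_lcs_lift[u lu ->]; apply/nil_proj_eq0. Qed.

Lemma nil_ind (P : free_nil K d t -> Prop) :
  (forall i, P (nil_gen K t i)) -> (forall x y, P x -> P y -> P (x + y)) ->
  (forall a x, P x -> P (a *: x)) -> (forall x y, P x -> P y -> P (lie x y)) ->
  P 0 -> forall x, P x.
Proof.
move=> Pg PD PZ Pl P0 x; rewrite -(nil_liftK x).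
elim/free_lie_ind: (nil_lift x) => [i|u v|a u|u v|].
- by rewrite nil_proj_gen.
- by rewrite linearD; apply: PD.
- by rewrite linearZ; apply: PZ.
- by rewrite nil_proj_lie; apply: Pl.
- by rewrite linear0.
Qed.

(** The homomorphism from the free algebra maps the term [t.+1] of its series into that of
    [free_nil], which is zero, so it descends to the quotient. *)
Lemma nil_universal (w : 'I_d -> free_nil K d t) :
  exists f : {linear free_nil K d t -> free_nil K d t},
    (forall i, f (nil_gen K t i) = w i) /\ {morph f : x y / lie x y >-> lie x y}.
Proof.
have [F [Fg Fl _]] := free_lie_universal w.
have FE u v : nil_proj u = nil_proj v -> F u = F v.
  move=> /nil_proj_eq uv; apply/eqP; rewrite -subr_eq0 -linearB.
  by apply/eqP/nil_lcs0/lie_morph_lcs.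
pose f x := F (nil_lift x).
have fE u : f (nil_proj u) = F u by apply: FE; rewrite nil_liftK.
have f_lin : linear f.
  move=> a x y; rewrite -(nil_liftK x) -(nil_liftK y) !fE -linearZ -linearD.
  by rewrite fE linearP.
pose f' : {linear free_nil K d t -> free_nil K d t} :=
  HB.pack_for {linear free_nil K d t -> free_nil K d t} f
    (GRing.isLinear.Build K _ _ *:%R f f_lin).
exists f'; split=> [i|x y] /=; first by rewrite -nil_proj_gen fE Fg.
by rewrite -(nil_liftK x) -(nil_liftK y) -nil_proj_lie !fE Fl.
Qed.

Lemma nil_endo_ext (f g : {linear free_nil K d t -> free_nil K d t}) :
  {morph f : x y / lie x y >-> lie x y} -> {morph g : x y / lie x y >-> lie x y} ->
  (forall i, f (nil_gen K t i) = g (nil_gen K t i)) -> f =1 g.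
Proof.
move=> fl gl fg; apply: nil_ind => [i|x y|a x|x y|]; first exact: fg.
- by rewrite !linearD => -> ->.
- by rewrite !linearZ => /= ->.
- by rewrite fl gl => -> ->.
- by rewrite !linear0.
Qed.

Lemma nil_unipotent (f : {linear free_nil K d t -> free_nil K d t}) :
  {morph f : x y / lie x y >-> lie x y} ->
  (forall i, lcs (free_nil K d t) 2 (f (nil_gen K t i) - nil_gen K t i)) ->
  bijective f.
Proof.
move=> fl fg; set L := free_nil K d t in f fl fg *.
have f1 x : lcs L 2 (f x - x).
  elim/nil_ind: x => [i|x y fx fy|a x fx|x y fx fy|]; first exact: fg.
  - by rewrite linearD opprD addrACA; apply: lcsD.
  - by rewrite linearZ -scalerBr; apply: lcsZ.
  - by rewrite fl; apply: lcsB; apply: (@lcs_lieS _ _ 0).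
  - by rewrite linear0 subrr; apply: lcs0.
(* On each term of the series, [f] is the identity modulo the next one, because f[u,v] - [u,v] =
   [fu - u, fv] + [u, fv - v]. *)
have fS i x : lcs L i.+1 x -> lcs L i.+2 (f x - x).
  elim: i x => [|i IH] x lx; first exact: f1.
  elim: lx => [|a u v y lu _ _ IHy]; first by rewrite linear0 subrr; apply: lcs0.
  rewrite linearD linearZ fl opprD addrACA -scalerBr; apply: lcsD => //; apply: lcsZ.
  rewrite -[lie (f u) _](subrK (lie u (f v))) -lieBl -addrA -lieBr.
  by apply: lcsD; [apply: lcs_lieS; apply: IH | rewrite -(addn1 i); apply: lcs_lie].
(* A kernel element therefore lies in every term of the series. *)
have inj : injective f.
  move=> x y fxy; apply/eqP; rewrite -subr_eq0; apply/eqP/nil_lcs0.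
  have: f (x - y) = 0 by rewrite linearB fxy subrr.
  move: (x - y) => z fz; suff H n : lcs L n.+1 z by apply: H.
  elim: n => // n IH; by have := fS n z IH; rewrite fz sub0r => /lcsN; rewrite opprK.
(* Induction from the last, zero term upwards: x - f x lies one term deeper and has a preimage y, so
   f (x + y) = x. *)
have surj n x : (n <= t)%N -> lcs L (t.+1 - n) x -> exists y, f y = x.
  elim: n x => [|n IH] x nt lx.
    by exists 0; rewrite linear0; apply/esym/nil_lcs0; rewrite subn0 in lx.
  have [y fy] : exists y, f y = x - f x.
    apply: IH; first exact: ltnW.
    rewrite -opprB; apply: lcsN; move: lx.
    by rewrite subSS -(subnSK nt) subSn 1?ltnW // -(subnSK nt); apply: fS.
  by exists (x + y); rewrite linearD fy addrC subrK.
have surj1 x : exists y, f y = x by apply: (surj t) => //; rewrite subSnn.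
have [g gK] := boolp.choice surj1.
by exists g => // x; apply: inj; rewrite gK.
Qed.

End FreeInduction.

Lemma ord2_ind (P : 'I_2 -> Prop) : P 0 -> P 1 -> forall i, P i.
Proof.
move=> P0 P1 [[|[|i]] // Hi]; last by rewrite (_ : Ordinal Hi = 1) //; apply: val_inj.
by rewrite (_ : Ordinal Hi = 0) //; apply: val_inj.
Qed.

Lemma hall_deg_le5 k : (k < 14)%N -> (hall_deg k < 6)%N.
Proof. by move: k; do 14! case=> //. Qed.

(** * Spanning by Hall elements modulo the sixth term *)

Section HallSpan.
Variables (K : fieldType) (L : lieAlgType K) (x1 x2 : L).
Local Notation h := (hall_seq x1 x2).

Lemma hall_seq_lcs j : (j < 14)%N -> lcs L (hall_deg j) h`_j.
Proof.
have h1 : lcs L 1 x1 by []. have h2 : lcs L 1 x2 by [].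
have h3 : lcs L 2 (lie x2 x1) by apply: lcs_lieS.
(* h_11 and h_13 are brackets with h_3, so their degree 5 needs the additivity of weights in
   [lcs_lie]; [lcs_lieS] alone would only give 4. *)
do 14! [case: j => [|j]; first by rewrite /= => _; repeat
  first [exact: h3 | exact: h1 | exact: h2
        | apply: (@lcs_lie _ _ 2 1 _ (lie x2 x1)) | apply: lcs_lieS]].
by [].
Qed.

Definition hall_comb (c : nat -> K) : L := \sum_(j < 14) c j *: h`_j.

Lemma hall_comb_lcs2 c : c 0%N = 0 -> c 1%N = 0 -> lcs L 2 (hall_comb c).
Proof.
move=> c0 c1; apply: big_ind => [|u v|[j j14] _] /=; [exact: lcs0 | exact: lcsD |].
case: j j14 => [|[|j]] j14; [by rewrite c0 scale0r; apply: lcs0 |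
  by rewrite c1 scale0r; apply: lcs0 |].
apply: lcsZ; apply: (lcs_le _ (hall_seq_lcs j14)).
by move: j j14; do 12! case=> //.
Qed.

Definition hall_spanned (v : L) : Prop := exists c, lcs L 6 (v - hall_comb c).

Lemma hall_spannedD u v : hall_spanned u -> hall_spanned v -> hall_spanned (u + v).
Proof.
move=> [c cu] [c' cv]; exists (fun j => c j + c' j).
rewrite (_ : hall_comb _ = hall_comb c + hall_comb c'); last first.
  by rewrite -big_split; apply: eq_bigr => j _; rewrite scalerDl.
by rewrite opprD addrACA; apply: lcsD.
Qed.

Lemma hall_spannedZ a v : hall_spanned v -> hall_spanned (a *: v).
Proof.
move=> [c cv]; exists (fun j => a * c j).
rewrite (_ : hall_comb _ = a *: hall_comb c); last first.
  by rewrite scaler_sumr; apply: eq_bigr => j _; rewrite scalerA.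
by rewrite -scalerBr; apply: lcsZ.
Qed.

Lemma hall_spannedN v : hall_spanned v -> hall_spanned (- v).
Proof. by rewrite -scaleN1r; apply: hall_spannedZ. Qed.

Lemma hall_spanned_lcs6 v : lcs L 6 v -> hall_spanned v.
Proof.
exists (fun=> 0); rewrite /hall_comb big1 ?subr0 // => j _.
by rewrite scale0r.
Qed.

Lemma hall_spanned0 : hall_spanned 0.
Proof. exact/hall_spanned_lcs6/lcs0. Qed.

Lemma hall_spanned_seq j : (j < 14)%N -> hall_spanned h`_j.
Proof.
move=> j14; exists (fun k => (k == j)%:R); rewrite /hall_comb.
rewrite (bigD1 (Ordinal j14)) //= eqxx scale1r big1 ?addr0 ?subrr; first exact: lcs0.
by move=> i ij; rewrite (_ : (_ == _) = false) ?scale0r //; apply/negbTE.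
Qed.

Lemma hall_spanned_lie_gen j : (j < 14)%N ->
  hall_spanned (lie h`_j x1) /\ hall_spanned (lie h`_j x2).
Proof.
have Sseq k v : h`_k = v -> (k < 14)%N -> hall_spanned v.
  by move=> <-; apply: hall_spanned_seq.
have top k x : (7 < k)%N -> (k < 14)%N -> hall_spanned (lie h`_k x).
  move=> k7 k14; apply/hall_spanned_lcs6/lcs_lieS.
  have := hall_seq_lcs k14; suff -> : hall_deg k = 5%N by [].
  by do 14! [case: k k7 k14 => [|k] k7 k14 //].
have [j7|j7 j14] := ltnP 7 j; first by move=> j14; split; apply: top.
(* The brackets that are not Hall elements by definition, straightened by Jacobi; in the first one
   [h_3,h_3] drops out. *)
have E51 : lie (lie (lie x2 x1) x2) x1 = h`_6 by rewrite lie_lieAC liexx addr0.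
have E71 : lie h`_6 x1 = h`_9 + h`_10 by rewrite [LHS]lie_lieAC.
have E81 : lie h`_7 x1 = h`_11 + h`_12 by rewrite [LHS]lie_lieAC E51.
case: j j7 j14 => [|[|[|[|[|[|[|[|j]]]]]]]] j7 j14 //; split.
- by rewrite liexx; apply: hall_spanned0.
- by rewrite lieC; apply/hall_spannedN/(Sseq 2%N).
- exact: (Sseq 2%N).
- by rewrite liexx; apply: hall_spanned0.
- exact: (Sseq 3%N).
- exact: (Sseq 4%N).
- exact: (Sseq 5%N).
- exact: (Sseq 6%N).
- by rewrite [lie _ _]E51; apply: hall_spanned_seq.
- exact: (Sseq 7%N).
- exact: (Sseq 8%N).
- exact: (Sseq 9%N).
- by rewrite E71; apply: hall_spannedD; apply: hall_spanned_seq.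
- exact: (Sseq 11%N).
- by rewrite E81; apply: hall_spannedD; apply: hall_spanned_seq.
- exact: (Sseq 13%N).
Qed.

Lemma hall_spanned_lie v : hall_spanned v ->
  hall_spanned (lie v x1) /\ hall_spanned (lie v x2).
Proof.
move=> [c]; rewrite -{2 3}[v](subrK (hall_comb c)); move: (v - _) => w lw.
have lw' x : lcs L 6 (lie w x) by exact/lcsS/lcs_lieS.
rewrite !lieDl !lie_suml; split; apply: hall_spannedD;
  try exact/hall_spanned_lcs6/lw'.
all: elim/big_ind: _ => [|u u'|j _];
  [exact: hall_spanned0 | exact: hall_spannedD | rewrite lieZl; apply: hall_spannedZ].
all: by have [] := hall_spanned_lie_gen (ltn_ord j).
Qed.

End HallSpan.

(** * Hall coordinates on the free Lie algebra *)

Section HallCoordinates.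
Variable K : fieldType.
Local Notation FL := (free_lie K 2).
Local Notation y1 := (free_gen K (0 : 'I_2)).
Local Notation y2 := (free_gen K (1 : 'I_2)).
Local Notation h := (hall_seq y1 y2).

Definition hall_map : {linear FL -> hall_model K} :=
  projT1 (cid (free_lie_universal (@hall_model_gen K))).

Lemma hall_map_gen i : hall_map (free_gen K i) = hall_model_gen K i.
Proof. by rewrite /hall_map; case: cid => f [fg _ _] /=. Qed.

Lemma hall_map_lie : {morph hall_map : x y / lie x y >-> lie x y}.
Proof. by rewrite /hall_map; case: cid => f [_ fl _] /=. Qed.

Lemma hall_mapD u v k : hall_map (u + v) k = hall_map u k + hall_map v k.
Proof. by rewrite linearD. Qed.

Lemma hall_mapZ a u k : hall_map (a *: u) k = a * hall_map u k.
Proof. by rewrite linearZ. Qed.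

Lemma hall_mapB u v k : hall_map (u - v) k = hall_map u k - hall_map v k.
Proof. by rewrite linearB. Qed.

(** Hall elements go to unit vectors of the model, which is their linear independence. *)
Lemma hall_map_seq j k : (j < 14)%N -> (k < 14)%N -> hall_map h`_j k = (j == k)%:R.
Proof.
move=> j14 k14.
do 14! [case: j j14 => [|j] j14; first by
  rewrite /= ?hall_map_lie !hall_map_gen /lie /= /hall_bracket /hall_model_gen;
  do 14! [case: k k14 => [|k] k14; first by rewrite /=; ring]].
by [].
Qed.

Lemma hall_map_lcs i u k : lcs FL i u -> (k < 14)%N -> (hall_deg k < i)%N ->
  hall_map u k = 0.
Proof. by move=> lu; apply: hall_model_lcs; apply: lie_morph_lcs hall_map_lie lu. Qed.

Lemma hall_map_comb c k : (k < 14)%N -> hall_map (hall_comb y1 y2 c) k = c k.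
Proof.
move=> k14; rewrite /hall_comb linear_sum.
rewrite (_ : (\sum_(j < 14) _) k = \sum_(j < 14) c j * hall_map h`_j k); last first.
  elim/big_rec2: _ => // j a x _ <-.
  by rewrite hall_modelD hall_mapZ.
rewrite (bigD1 (Ordinal k14)) //= hall_map_seq // eqxx mulr1 big1 ?addr0 //.
move=> j jk; rewrite hall_map_seq //.
by rewrite (_ : (_ == _) = false) ?mulr0 //; apply/negbTE.
Qed.

(* The elements acting on the span from the right form a subalgebra. *)
Lemma free_hall_spanned v : hall_spanned y1 y2 v.
Proof.
pose N w := forall s, hall_spanned y1 y2 s -> hall_spanned y1 y2 (lie s w).
have NP w : N w.
  elim/free_lie_ind: w => [i|u u' Nu Nu'|a u Nu|u u' Nu Nu'|] s Ss.
  - by have [? ?] := hall_spanned_lie Ss; elim/ord2_ind: i.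
  - by rewrite lieDr; apply: hall_spannedD; [apply: Nu | apply: Nu'].
  - by rewrite lieZr; apply/hall_spannedZ/Nu.
  - rewrite lie_jacobir; apply: hall_spannedD; first exact/Nu'/Nu.
    exact/hall_spannedN/Nu/Nu'.
  - by rewrite lie0r; apply: hall_spanned0.
elim/free_lie_ind: v => [i|u u'|a u|u u' Su _|].
- elim/ord2_ind: i.
  + exact: (@hall_spanned_seq _ _ y1 y2 0).
  + exact: (@hall_spanned_seq _ _ y1 y2 1).
- exact: hall_spannedD.
- exact: hall_spannedZ.
- exact: NP.
- exact: hall_spanned0.
Qed.

(** Some expansion exists by spanning. Applying [hall_map], whose first 14 coordinates vanish on the
    sixth term, shows that its coefficients can only be these. *)
Lemma hall_expansion v : lcs FL 6 (v - hall_comb y1 y2 (hall_map v)).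
Proof.
have [c cv] := free_hall_spanned v.
suff -> : hall_comb y1 y2 (hall_map v) = hall_comb y1 y2 c by [].
apply: eq_bigr => j _; congr (_ *: _); rewrite -[RHS](hall_map_comb c) //.
apply/eqP; rewrite -subr_eq0 -hall_mapB; apply/eqP.
by apply: hall_map_lcs cv _ _ => //; apply: hall_deg_le5.
Qed.

End HallCoordinates.

(** * Invariant forms *)

Section InvariantForms.
Variables (K : fieldType) (L : lieAlgType K).

(** [is_sym0] without its two conditions on the kernel, and over any Lie algebra, so that it applies
    alike to the model, the free algebra and its quotients. *)
Record inv_sym_form (B : L -> L -> K) : Prop := InvSymForm {
  form_bilinear : Defs.bilinear_form B;
  form_sym : Defs.symmetric_form B;
  form_inv : Defs.invariant_form B
}.

Section Theory.
Variables (B : L -> L -> K) (BP : inv_sym_form B).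

Lemma inv_formPl a x y z : B (a *: x + y) z = a * B x z + B y z.
Proof. by have [[Bl _] _ _] := BP; apply: Bl. Qed.

Lemma inv_formPr a x y z : B z (a *: x + y) = a * B z x + B z y.
Proof. by rewrite !(form_sym BP z) inv_formPl. Qed.

Lemma inv_formDl x y z : B (x + y) z = B x z + B y z.
Proof. by rewrite -[x]scale1r inv_formPl mul1r scale1r. Qed.

Lemma inv_formDr x y z : B z (x + y) = B z x + B z y.
Proof. by rewrite !(form_sym BP z) inv_formDl. Qed.

Lemma inv_form0l y : B 0 y = 0.
Proof. by apply: (addrI (B 0 y)); rewrite -inv_formDl !addr0. Qed.

Lemma inv_form0r y : B y 0 = 0.
Proof. by rewrite (form_sym BP) inv_form0l. Qed.

Lemma inv_formZl a x z : B (a *: x) z = a * B x z.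
Proof. by rewrite -[a *: x]addr0 inv_formPl inv_form0l addr0. Qed.

Lemma inv_formZr a x z : B z (a *: x) = a * B z x.
Proof. by rewrite !(form_sym BP z) inv_formZl. Qed.

Lemma inv_formNl x y : B (- x) y = - B x y.
Proof. by rewrite -scaleN1r inv_formZl mulN1r. Qed.

Lemma inv_formNr x y : B x (- y) = - B x y.
Proof. by rewrite -scaleN1r inv_formZr mulN1r. Qed.

Lemma inv_form_lier u v x : B u (lie v x) = - B (lie u x) v.
Proof. by rewrite lieC inv_formNr (form_inv BP). Qed.

Lemma inv_form_ker_lie u v : (forall y, B u y = 0) -> forall y, B (lie u v) y = 0.
Proof. by move=> Bu y; rewrite (form_inv BP). Qed.

End Theory.

Lemma inv_sym_formB B B' :
  inv_sym_form B -> inv_sym_form B' -> inv_sym_form (fun x y => B x y - B' x y).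
Proof.
move=> BP BP'; split; first split=> z a x y.
- by rewrite (inv_formPl BP) (inv_formPl BP') /=; ring.
- by rewrite (inv_formPr BP) (inv_formPr BP') /=; ring.
- by move=> x y; rewrite (form_sym BP) (form_sym BP').
- by move=> x y z; rewrite (form_inv BP) (form_inv BP').
Qed.

End InvariantForms.

Lemma inv_sym_form_pull (K : fieldType) (L L' : lieAlgType K) (f : {linear L -> L'}) B :
  {morph f : x y / lie x y >-> lie x y} -> inv_sym_form B ->
  inv_sym_form (fun x y => B (f x) (f y)).
Proof.
move=> fl BP; split; first split=> z a x y.
- by rewrite linearP (inv_formPl BP).
- by rewrite linearP (inv_formPr BP).
- by move=> x y; apply: form_sym BP _ _.
- by move=> x y z; rewrite !fl (form_inv BP).
Qed.

Section GramData.
Variables (K : fieldType) (L : lieAlgType K) (g : 'I_2 -> L) (B : L -> L -> K).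

(** The three Gram data are taken at an arbitrary pair [g], so that they can also be evaluated at
    the images of the generators under an endomorphism. *)
Definition gram1 : 'M[K]_2 := \matrix_(i, j) B (g i) (g j).

Definition gram2 : K := B (lie (g 1) (g 0)) (lie (g 1) (g 0)).

Definition gram3 : 'M[K]_2 :=
  \matrix_(i, j) B (lie (lie (g 1) (g 0)) (g i)) (lie (lie (g 1) (g 0)) (g j)).

Lemma gram1_sym : inv_sym_form B -> gram1^T = gram1.
Proof. by move=> BP; apply/matrixP => i j; rewrite !mxE (form_sym BP). Qed.

Lemma gram3_sym : inv_sym_form B -> gram3^T = gram3.
Proof. by move=> BP; apply/matrixP => i j; rewrite !mxE (form_sym BP). Qed.

End GramData.

Lemma gram1B (K : fieldType) (L : lieAlgType K) (g : 'I_2 -> L) B B' :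
  gram1 g (fun x y => B x y - B' x y) = gram1 g B - gram1 g B'.
Proof. by apply/matrixP => i j; rewrite !mxE. Qed.

Lemma gram3B (K : fieldType) (L : lieAlgType K) (g : 'I_2 -> L) B B' :
  gram3 g (fun x y => B x y - B' x y) = gram3 g B - gram3 g B'.
Proof. by apply/matrixP => i j; rewrite !mxE. Qed.

(** * Forms on the free Lie algebra with prescribed Gram data *)

Section HallForm.
Variable K : fieldType.
Local Notation FL := (free_lie K 2).
Local Notation y1 := (free_gen K (0 : 'I_2)).
Local Notation y2 := (free_gen K (1 : 'I_2)).
Local Notation h := (hall_seq y1 y2).
Implicit Types (A : 'M[K]_2) (c : K).

Lemma free_form_eq0 (D : FL -> FL -> K) : inv_sym_form D ->
  (forall u v, lcs FL 6 u -> D u v = 0) ->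
  gram1 (@free_gen K 2) D = 0 -> gram2 (@free_gen K 2) D = 0 ->
  gram3 (@free_gen K 2) D = 0 -> forall u v, D u v = 0.
Proof.
move=> DP D6 D1 D33 D3.
have Dg i j : D (free_gen K i) (free_gen K j) = 0.
  by have /matrixP/(_ i j) := D1; rewrite !mxE.
have Dh i j : D (lie (lie y2 y1) (free_gen K i)) (lie (lie y2 y1) (free_gen K j)) = 0.
  by have /matrixP/(_ i j) := D3; rewrite !mxE.
rewrite /gram2 in D33.
have red i : (forall j, (j < 14)%N -> D (free_gen K i) h`_j = 0) ->
    forall v, D (free_gen K i) v = 0.
  move=> Dij v; rewrite -[v](subrK (hall_comb y1 y2 (hall_map K v))) (inv_formDr DP).
  rewrite (form_sym DP) D6 ?add0r; last exact: hall_expansion.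
  apply: (big_ind (fun u => D (free_gen K i) u = 0)) => [|u w Du Dw|j _].
  - exact: inv_form0r.
  - by rewrite (inv_formDr DP) Du Dw addr0.
  - by rewrite (inv_formZr DP) Dij ?mulr0.
(* Values at h_3: on the generators and on h_4, h_5 invariance produces a bracket [x,x]; in degree 4
   it leads back to the entries of [gram3]. *)
have D3y i : D (lie y2 y1) (free_gen K i) = 0.
  elim/ord2_ind: i; first by rewrite (form_inv DP) liexx (inv_form0r DP).
  by rewrite (form_sym DP) -(form_inv DP) liexx (inv_form0l DP).
have D3h i : D (lie y2 y1) (lie (lie y2 y1) (free_gen K i)) = 0.
  by rewrite -(form_inv DP) liexx (inv_form0l DP).
have D3l v i : D (lie y2 y1) (lie (lie (lie y2 y1) (free_gen K v)) (free_gen K i)) = 0.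
  by rewrite (inv_form_lier DP) Dh oppr0.
(* Moving the last factor of a Hall bracket across leaves a vanishing bracket, h_3 paired with an
   element of degree at most 4, or an entry of [gram3]. *)
have Dy1 v : D y1 v = 0.
  apply: red => j; do 14! [case: j => [|j]; first by rewrite /= => _;
    rewrite ?Dg // (inv_form_lier DP) ?liexx ?(inv_form0l DP) ?oppr0 //
      (lieC y1) (inv_formNl DP) opprK ?D33 ?D3y ?D3h ?D3l ?Dh].
  by [].
have Dy2 v : D y2 v = 0.
  apply: red => j; do 14! [case: j => [|j]; first by rewrite /= => _;
    rewrite ?Dg // (inv_form_lier DP) ?liexx ?(inv_form0l DP) ?oppr0 //
      1?(lieC y2 (lie y2 y1)) ?(inv_formNl DP) ?opprK ?D33 ?D3y ?D3h ?D3l ?Dh ?oppr0].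
  by [].
elim/free_lie_ind => [i|u v Du Dv|a u Du|u v Du _|].
- by elim/ord2_ind: i.
- by move=> w; rewrite (inv_formDl DP) Du Dv addr0.
- by move=> w; rewrite (inv_formZl DP) Du mulr0.
- exact: inv_form_ker_lie.
- by move=> w; apply: inv_form0l.
Qed.

Lemma hall_form_inv_sym A c A' : inv_sym_form (hall_form A c A').
Proof.
split; last exact: hall_form_inv.
- split=> z a x y; rewrite /hall_form !hall_modelD !hall_modelZ; ring.
- by move=> x y; rewrite /hall_form; ring.
Qed.

Definition free_form A c A' : FL -> FL -> K :=
  fun u v => hall_form A c A' (hall_map K u) (hall_map K v).

Lemma free_form_inv_sym A c A' : inv_sym_form (free_form A c A').
Proof. apply: inv_sym_form_pull; [exact: hall_map_lie | exact: hall_form_inv_sym]. Qed.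

(** The form reads coordinates of degree at most 5, at most 3 if [A'] is zero, and only 1 if [c] is
    zero too. This and the next two lemmas are used both to descend to the quotients and to locate
    the kernel. *)
Lemma free_form_lcs6 A c A' u v : lcs FL 6 u -> free_form A c A' u v = 0.
Proof.
move=> lu; have Z k : (k < 14)%N -> hall_map K u k = 0.
  by move=> k14; apply: (hall_map_lcs lu k14); apply: hall_deg_le5.
by rewrite /free_form /hall_form !Z //; ring.
Qed.

Lemma free_form_lcs2 A u v : lcs FL 2 u -> free_form A 0 0 u v = 0.
Proof.
move=> lu; have Z k : (k < 14)%N -> (hall_deg k < 2)%N -> hall_map K u k = 0.
  exact: hall_map_lcs.
by rewrite /free_form /hall_form !mxE !(Z 0%N) // !(Z 1%N) //; ring.
Qed.

Lemma free_form_lcs4 A c u v : lcs FL 4 u -> free_form A c 0 u v = 0.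
Proof.
move=> lu; have Z k : (k < 14)%N -> (hall_deg k < 4)%N -> hall_map K u k = 0.
  exact: hall_map_lcs.
rewrite /free_form /hall_form !mxE !(Z 0%N) // !(Z 1%N) // !(Z 2%N) //.
by rewrite !(Z 3%N) // !(Z 4%N) //; ring.
Qed.

Lemma free_form_seq A c A' u j : (j < 14)%N ->
  free_form A c A' u h`_j = hall_form A c A' (hall_map K u) (fun k => (j == k)%:R).
Proof. by move=> j14; rewrite /free_form /hall_form !hall_map_seq. Qed.

Let E := (hall_map_lie, hall_map_gen).

Lemma free_form_gram1 A c A' : A^T = A -> gram1 (@free_gen K 2) (free_form A c A') = A.
Proof.
move=> As; apply/matrixP => i j; rewrite mxE /free_form !E /hall_form /hall_model_gen.
have A10 : A 1 0 = A 0 1 by rewrite -[in LHS]As mxE.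
by elim/ord2_ind: i; elim/ord2_ind: j => /=; rewrite ?A10; ring.
Qed.

Lemma free_form_gram2 A c A' : gram2 (@free_gen K 2) (free_form A c A') = c.
Proof.
rewrite /gram2 /free_form !E /hall_form /hall_model_gen /lie /= /hall_bracket /=; ring.
Qed.

Lemma free_form_gram3 A c A' : A'^T = A' -> gram3 (@free_gen K 2) (free_form A c A') = A'.
Proof.
move=> As; apply/matrixP => i j; rewrite mxE /free_form !E /hall_form /hall_model_gen.
have A10 : A' 1 0 = A' 0 1 by rewrite -[in LHS]As mxE.
by elim/ord2_ind: i; elim/ord2_ind: j; rewrite /lie /= /hall_bracket /= ?A10; ring.
Qed.

(** The difference of the two forms has zero Gram data, since [free_form] returns the symmetric
    matrices it was given. *)
Lemma free_formE (B : FL -> FL -> K) : inv_sym_form B ->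
  (forall u v, lcs FL 6 u -> B u v = 0) ->
  forall u v, B u v = free_form (gram1 (@free_gen K 2) B) (gram2 (@free_gen K 2) B)
    (gram3 (@free_gen K 2) B) u v.
Proof.
move=> BP B6 u v; apply/eqP; rewrite -subr_eq0; apply/eqP; move: u v.
apply: free_form_eq0.
- exact/inv_sym_formB/free_form_inv_sym.
- by move=> u v lu; rewrite B6 // free_form_lcs6 // subrr.
- rewrite -[LHS]/(gram1 _ (fun u v => B u v - free_form _ _ _ u v)) gram1B.
  by rewrite free_form_gram1 ?subrr //; apply: gram1_sym.
- by rewrite /gram2; apply/eqP; rewrite subr_eq0; apply/eqP/esym/free_form_gram2.
- rewrite -[LHS]/(gram3 _ (fun u v => B u v - free_form _ _ _ u v)) gram3B.
  by rewrite free_form_gram3 ?subrr //; apply: gram3_sym.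
Qed.

End HallForm.

(** * Forms on the free nilpotent algebra on two generators *)

Section NilForms.
Variables (K : fieldType) (t : nat).
Local Notation FL := (free_lie K 2).
Local Notation n := (free_nil K 2 t).
Local Notation y1 := (free_gen K (0 : 'I_2)).
Local Notation y2 := (free_gen K (1 : 'I_2)).
Local Notation h := (hall_seq y1 y2).
Local Notation proj := (@nil_proj K 2 t).
Local Notation lift := (@nil_lift K 2 t).
Local Notation g := (@nil_gen K 2 t).
Implicit Types (A : 'M[K]_2) (c : K).

(** Invariance moves factors from [u] to [v] until [v] lies in the term [t.+1], which is zero. The
    condition says that the weights i+1 and j+1 add up to more than t+1. *)
Lemma form_orthogonal B i j u v : inv_sym_form B -> (t <= i + j)%N ->
  lcs n i.+1 u -> lcs n j.+1 v -> B u v = 0.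
Proof.
move=> BP; elim: i j u v => [|i IH] j u v tij lu lv.
  have -> : v = 0 by apply/nil_lcs0/(lcs_le _ lv).
  exact: inv_form0r.
elim: lu => [|a x y z lx _ _ IHz]; first exact: inv_form0l.
rewrite (inv_formPl BP) IHz (form_inv BP) (IH j.+1) ?mulr0 ?addr0 ?addnS //.
by rewrite lieC; apply/lcsN/lcs_lieS.
Qed.

Lemma inv_form_projE (B : n -> n -> K) u v : (t <= 5)%N -> inv_sym_form B ->
  B (proj u) (proj v) = free_form (gram1 g B) (gram2 g B) (gram3 g B) u v.
Proof.
move=> t5 BP; pose B' u v := B (proj u) (proj v).
have B'P : inv_sym_form B' by apply: inv_sym_form_pull => //; apply: nil_proj_lie.
have B'6 x y : lcs FL 6 x -> B' x y = 0.
  move=> lx; rewrite /B' (_ : proj x = 0) ?(inv_form0l BP) //; apply/nil_proj_eq0.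
  by apply: (lcs_le _ lx).
rewrite -/(B' _ _) (free_formE B'P B'6); congr (free_form _ _ _ _ _).
- by rewrite /gram2 /B' !nil_proj_lie.
- by apply/matrixP => i j; rewrite !mxE /B' !nil_proj_lie.
Qed.

(** [lift] picks an arbitrary representative; the hypothesis [kill] below makes the value
    independent of that choice. *)
Definition nil_form A c A' : n -> n -> K :=
  fun x y => free_form A c A' (lift x) (lift y).

Lemma nil_formE (B : n -> n -> K) : (t <= 5)%N -> inv_sym_form B ->
  B = nil_form (gram1 g B) (gram2 g B) (gram3 g B).
Proof.
move=> t5 BP; apply/funext => x; apply/funext => y.
by rewrite -[x in LHS]nil_liftK -[y in LHS]nil_liftK inv_form_projE.
Qed.

Lemma nil_lift_lcs i x : (i <= t.+1)%N -> lcs n i x -> lcs FL i (lift x).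
Proof.
move=> it /nil_lcs_lift[u lu xu]; rewrite -(subrK u (lift x)); apply: lcsD => //.
by apply: (lcs_le it); apply/nil_proj_eq; rewrite nil_liftK.
Qed.

Lemma nil_form_lcs2 A x y : (1 <= t)%N -> lcs n 2 x -> nil_form A 0 0 x y = 0.
Proof. by move=> t1 lx; apply/free_form_lcs2/nil_lift_lcs. Qed.

Lemma nil_form_lcs4 A c x y : (3 <= t)%N -> lcs n 4 x -> nil_form A c 0 x y = 0.
Proof. by move=> t3 lx; apply/free_form_lcs4/nil_lift_lcs. Qed.

Section Descent.
Variables (A : 'M[K]_2) (c : K) (A' : 'M[K]_2).
Hypothesis kill : forall u v, lcs FL t.+1 u -> free_form A c A' u v = 0.

Lemma nil_form_proj u v : nil_form A c A' (proj u) (proj v) = free_form A c A' u v.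
Proof.
have FP := free_form_inv_sym A c A'.
have kl w z : free_form A c A' (lift (proj w)) z = free_form A c A' w z.
  rewrite -[lift _](subrK w) (inv_formDl FP) kill ?add0r //.
  by apply/nil_proj_eq; rewrite nil_liftK.
by rewrite /nil_form kl (form_sym FP) kl (form_sym FP).
Qed.

Lemma nil_form_inv_sym : inv_sym_form (nil_form A c A').
Proof.
have FP := free_form_inv_sym A c A'.
split; first split=> z a x y.
- rewrite -(nil_liftK x) -(nil_liftK y) -(nil_liftK z) -linearP !nil_form_proj.
  exact: inv_formPl.
- rewrite -(nil_liftK x) -(nil_liftK y) -(nil_liftK z) -linearP !nil_form_proj.
  exact: inv_formPr.
- by move=> x y; apply: form_sym FP _ _.
- move=> x y z; rewrite -(nil_liftK x) -(nil_liftK y) -(nil_liftK z).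
  by rewrite -!nil_proj_lie !nil_form_proj (form_inv FP).
Qed.

Lemma nil_form_gram1 : A^T = A -> gram1 g (nil_form A c A') = A.
Proof.
move=> As; rewrite -[RHS](free_form_gram1 c A' As).
by apply/matrixP => i j; rewrite !mxE -!nil_proj_gen nil_form_proj.
Qed.

Lemma nil_form_gram2 : gram2 g (nil_form A c A') = c.
Proof.
rewrite -[RHS](free_form_gram2 A c A') /gram2 -!nil_proj_gen -!nil_proj_lie.
exact: nil_form_proj.
Qed.

Lemma nil_form_gram3 : A'^T = A' -> gram3 g (nil_form A c A') = A'.
Proof.
move=> As; rewrite -[RHS](free_form_gram3 A c As).
by apply/matrixP => i j; rewrite !mxE -!nil_proj_gen -!nil_proj_lie nil_form_proj.
Qed.

Lemma nil_lcs2 x : (t <= 5)%N ->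
  hall_map K (lift x) 0%N = 0 -> hall_map K (lift x) 1%N = 0 -> lcs n 2 x.
Proof.
move=> t5 x0 x1; rewrite -(nil_liftK x); apply: lie_morph_lcs; first exact: nil_proj_lie.
rewrite -(subrK (hall_comb y1 y2 (hall_map K (lift x))) (lift x)); apply: lcsD.
  by apply: (lcs_le _ (hall_expansion _)).
exact: hall_comb_lcs2.
Qed.

(** One criterion serves both conditions on the kernel: pairing with the Hall elements of degree [t]
    detects the two coordinates of degree 1. Were [n^t] in the kernel, the first coordinate of the
    generator [y1] would vanish as well, but it is 1. *)
Lemma nil_form_is_sym0 : (1 <= t <= 5)%N ->
  (forall u, (forall j, (j < 14)%N -> hall_deg j = t -> free_form A c A' u h`_j = 0) ->
     hall_map K u 0%N = 0 /\ hall_map K u 1%N = 0) ->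
  is_sym0 (nil_form A c A').
Proof.
move=> /andP[t1 t5] nondeg; have [b s i] := nil_form_inv_sym; split=> //.
- move=> x kx; have [|x0 x1] := nondeg (lift x); last exact: nil_lcs2.
  by move=> j j14 jt; rewrite -nil_form_proj nil_liftK kx.
- move=> top; have [|] := nondeg y1; last first.
    by rewrite hall_map_gen => /eqP; rewrite oner_eq0.
  move=> j j14 jt; rewrite -nil_form_proj s; apply: top.
  by apply: lie_morph_lcs; [exact: nil_proj_lie | rewrite -jt; apply: hall_seq_lcs].
Qed.

End Descent.

(** [coords] is a choice, so its value is known only once the expansion is unique. The last
    hypothesis says that the first [m] Hall elements are those of degree at most [t]. *)
Lemma nil_coords m x : (m <= 14)%N -> (t <= 5)%N ->
  (forall j, (j < 14)%N -> (j < m)%N = (hall_deg j <= t)%N) ->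
  coords (fun i : 'I_m => (hall_seq (g 0) (g 1))`_i) x = \row_i hall_map K (lift x) i.
Proof.
move=> m14 t5 mt.
have projh j : (j < 14)%N -> proj h`_j = (hall_seq (g 0) (g 1))`_j.
  by do 14! [case: j => [|j]; first by rewrite /= ?nil_proj_lie ?nil_proj_gen].
(* Hall elements of degree above [t] vanish in the quotient, which truncates the sum at [m]. *)
have comb (f : nat -> K) :
    proj (hall_comb y1 y2 f) = \sum_(i < m) f i *: (hall_seq (g 0) (g 1))`_i.
  rewrite (big_ord_widen _ (fun i => f i *: _`_i) m14).
  transitivity (\sum_(j < 14) if (j < m)%N then f j *: (hall_seq (g 0) (g 1))`_j else 0);
    last by rewrite [RHS]big_mkcond.
  transitivity (\sum_(j < 14) proj (f j *: h`_j)); first exact: linear_sum.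
  apply: eq_bigr => j _; rewrite linearZ /= projh // mt //; case: leqP => // tj.
  rewrite -projh // (_ : proj _ = 0) ?scaler0 //; apply/nil_proj_eq0.
  exact: (lcs_le _ (hall_seq_lcs _ _ _)).
apply: xget_unique => [|c' xc'] /=.
  under eq_bigr do rewrite mxE.
  rewrite -comb -[LHS]nil_liftK; apply/nil_proj_eq.
  by apply: (lcs_le _ (hall_expansion _)).
(* A competing coordinate vector is padded with zeros so that its Hall coordinates can be compared
   with those of [x]. *)
pose cc j := if insub j is Some i then c' 0 i else 0.
have xcc : proj (lift x) = proj (hall_comb y1 y2 cc).
  rewrite nil_liftK comb [LHS]xc'; apply: eq_bigr => i _.
  by rewrite /cc insubT //= => im; congr (c' 0 _ *: _); apply: val_inj.
apply/rowP => i; rewrite mxE.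
have i14 : (i < 14)%N by apply: leq_trans m14.
have -> : c' 0 i = cc i.
  by rewrite /cc insubT //= => im; congr (c' 0 _); apply: val_inj.
move/nil_proj_eq: xcc => /hall_map_lcs/(_ i14); rewrite hall_mapB.
rewrite hall_map_comb // ltnS -mt // ltn_ord => /(_ isT)/eqP.
by rewrite subr_eq0 => /eqP ->.
Qed.

End NilForms.

(** * The tabulated forms in Hall coordinates *)

Section Tables.
Variable K : fieldType.

Lemma gram_of_tableE m (u : nat -> nat -> K) (c c' : nat -> K) :
  ((\row_(i < m) c i) *m gram_of_table m u *m (\row_(i < m) c' i)^T) 0 0 =
  \sum_(j < m) \sum_(i < m) c i * u (minn i j).+1 (maxn i j).+1 * c' j.
Proof.
rewrite mxE; apply: eq_bigr => j _; rewrite !mxE big_distrl.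
by apply: eq_bigr => i _; rewrite !mxE.
Qed.

Lemma B23E A gamma : @B23 K A gamma = @nil_form K 3 A gamma 0.
Proof.
apply/funext => x; apply/funext => y; rewrite /B23 /form_of_gram /hall23.
rewrite !nil_coords //; try by do 14! case=> //.
rewrite gram_of_tableE /nil_form /free_form /hall_form !mxE.
move: (hall_map K _) (hall_map K _) => c' c.
by rewrite !big_ord_recr !big_ord0 /=; ring.
Qed.

Lemma big_ord14 (F : nat -> K) : \sum_(i < 14) F i =
  F 0%N + F 1%N + F 2%N + F 3%N + F 4%N + F 5%N + F 6%N + F 7%N + F 8%N + F 9%N
  + F 10%N + F 11%N + F 12%N + F 13%N.
Proof. by rewrite !big_ord_recr big_ord0 /= add0r. Qed.

Lemma B25E A1 gamma A2 : @B25 K A1 gamma A2 = @nil_form K 5 A1 gamma A2.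
Proof.
apply/funext => x; apply/funext => y; rewrite /B25 /form_of_gram /hall25.
rewrite !nil_coords //; try by do 14! case=> //.
rewrite gram_of_tableE /nil_form /free_form /hall_form.
move: (hall_map K _) (hall_map K _) => c' c.
pose u i j := table25 A1 gamma A2 (minn i j).+1 (maxn i j).+1.
have uE j : \sum_(i < 14) c i * u i j * c' j = _ :=
  big_ord14 (fun i => c i * u i j * c' j).
etransitivity; first exact: (big_ord14 (fun j => \sum_(i < 14) c i * u i j * c' j)).
by cbv beta; rewrite !uE /u /=; ring.
Qed.

End Tables.

(** * Classification of the objects *)

Section Objects.
Variable K : fieldType.
Implicit Types A : 'M[K]_2.

Lemma sym0_inv_sym_form t (B : free_nil K 2 t -> free_nil K 2 t -> K) :
  is_sym0 B -> inv_sym_form B.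
Proof. by case. Qed.

Lemma gram3_eq0 t (B : free_nil K 2 t -> free_nil K 2 t -> K) :
  (t <= 4)%N -> inv_sym_form B -> gram3 (@nil_gen K 2 t) B = 0.
Proof.
move=> t4 BP; apply/matrixP => i j; rewrite !mxE.
by apply: (@form_orthogonal _ _ _ 2 2 _ _ BP t4); do !apply: lcs_lieS.
Qed.

(** Only [gram1] survives, and a form given by [gram1] alone kills [n^2], against [sym0_top]. *)
Lemma no_sym0_22 (B : free_nil K 2 2 -> free_nil K 2 2 -> K) : ~ is_sym0 B.
Proof.
move=> B0; have BP := sym0_inv_sym_form B0; apply: (sym0_top B0) => x lx y.
rewrite (nil_formE _ BP) // gram3_eq0 //.
rewrite (_ : gram2 _ _ = 0) ?nil_form_lcs2 //.
by apply: (@form_orthogonal _ _ _ 1 1 _ _ BP) => //; apply: lcs_lieS.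
Qed.

(** Without [gram3] the form reads only coordinates of degree at most 3 and so kills [n^4]. *)
Lemma no_sym0_24 (B : free_nil K 2 4 -> free_nil K 2 4 -> K) : ~ is_sym0 B.
Proof.
move=> B0; have BP := sym0_inv_sym_form B0; apply: (sym0_top B0) => x lx y.
by rewrite (nil_formE _ BP) // gram3_eq0 // nil_form_lcs4.
Qed.

(** Applied with [z] a pairing known to vanish and [s] a sign, which leaves a polynomial identity to
    [ring]. *)
Lemma eq0_of_mul (s a b z : K) : a != 0 -> z = 0 -> a * b = s * z -> b = 0.
Proof. by move=> a0 -> ; rewrite mulr0 => /eqP; rewrite mulf_eq0 (negbTE a0) => /eqP. Qed.

Lemma sym0_23P (B : free_nil K 2 3 -> free_nil K 2 3 -> K) :
  is_sym0 B <->
  exists A gamma, A^T = A /\ gamma != 0 /\ B = B23 A gamma.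
Proof.
split=> [B0|[A [c [As [c0 ->]]]]].
  have BP := sym0_inv_sym_form B0; have BE := nil_formE (isT : 3 <= 5)%N BP.
  exists (gram1 (@nil_gen K 2 3) B), (gram2 (@nil_gen K 2 3) B).
  rewrite B23E; split; first exact: gram1_sym.
  split; last by rewrite [LHS]BE gram3_eq0.
  apply/eqP => g0; apply: (sym0_top B0) => x /lcsS lx y.
  by rewrite BE gram3_eq0 // g0 nil_form_lcs2.
rewrite B23E; apply: nil_form_is_sym0 => // [u v|u Bu]; first exact: free_form_lcs4.
(* Pairing with h_4 and h_5 gives -gamma and gamma times the second and the first coordinate. *)
have := Bu 3 isT erefl; have := Bu 4 isT erefl.
rewrite !free_form_seq // /hall_form !mxE /= => x0 x1; split.
  by apply: (eq0_of_mul (s := 1) c0 x0); ring.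
by apply: (eq0_of_mul (s := -1) c0 x1); ring.
Qed.

Lemma mx2_eq0 A : A^T = A -> (A == 0) = [&& A 0 0 == 0, A 0 1 == 0 & A 1 1 == 0].
Proof.
move=> As; apply/eqP/and3P => [->|[/eqP a /eqP b /eqP c]]; first by rewrite !mxE.
have d : A 1 0 = 0 by rewrite -As mxE.
by apply/matrixP => i j; rewrite mxE; elim/ord2_ind: i; elim/ord2_ind: j.
Qed.

Lemma sym0_25P (B : free_nil K 2 5 -> free_nil K 2 5 -> K) :
  is_sym0 B <->
  exists A1 gamma A2,
    A1^T = A1 /\ A2^T = A2 /\ (1 <= \rank A2)%N /\ B = B25 A1 gamma A2.
Proof.
split=> [B0|[A1 [c [A2 [As1 [As2 [A20 ->]]]]]]].
  have BP := sym0_inv_sym_form B0; have BE := nil_formE (isT : 5 <= 5)%N BP.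
  exists (gram1 (@nil_gen K 2 5) B), (gram2 (@nil_gen K 2 5) B),
    (gram3 (@nil_gen K 2 5) B).
  rewrite B25E; split; first exact: gram1_sym.
  split; [exact: gram3_sym | split; last exact: BE].
  rewrite lt0n mxrank_eq0; apply/eqP => g0; apply: (sym0_top B0) => x /lcsS lx y.
  by rewrite BE g0 nil_form_lcs4.
rewrite B25E; apply: nil_form_is_sym0 => // [u v|u Bu]; first exact: free_form_lcs6.
move: A20; rewrite lt0n mxrank_eq0 mx2_eq0 //.
have := Bu 8 isT erefl; have := Bu 9 isT erefl; have := Bu 10 isT erefl.
have := Bu 11 isT erefl; have := Bu 12 isT erefl; have := Bu 13 isT erefl.
rewrite !free_form_seq // /hall_form /=; move: (hall_map K u) => x.
(* The first nonzero one among the entries d, e, f of [A2] selects the pair of Hall elements that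
   detects both coordinates: h_9, h_10 for d, h_11, h_12 for e, and h_13, h_14 for f. *)
have [->|d0 _ _ _ _ E9 E8 _] := eqVneq (A2 0 0) 0; last first.
  by split; [apply: (eq0_of_mul (s := -1) d0 E9) | apply: (eq0_of_mul (s := 1) d0 E8)];
    ring.
have [-> E13 E12 _ _ _ _|e0 _ _ E11 E10 _ _ _] := eqVneq (A2 0 1) 0; last first.
  by split; [apply: (eq0_of_mul (s := -1) e0 E11) | apply: (eq0_of_mul (s := 1) e0 E10)];
    ring.
move=> /= f0.
by split; [apply: (eq0_of_mul (s := -1) f0 E13) | apply: (eq0_of_mul (s := 1) f0 E12)];
  ring.
Qed.

End Objects.

Lemma det_mx22 (R : comNzRingType) (P : 'M[R]_2) :
  \det P = P 0 0 * P 1 1 - P 0 1 * P 1 0.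
Proof.
rewrite (expand_det_row _ ord0) !big_ord_recl big_ord0 /cofactor !det_mx11 !mxE /=.
rewrite (_ : lift ord0 ord0 = 1); last exact: val_inj.
rewrite (_ : lift 1 0 = 0); last exact: val_inj.
by rewrite expr0 expr1; ring.
Qed.

Lemma mulmx22 (R : pzSemiRingType) (P Q : 'M[R]_2) i j :
  (P *m Q) i j = P i 0 * Q 0 j + P i 1 * Q 1 j.
Proof.
rewrite mxE !big_ord_recl big_ord0 addr0.
by rewrite (_ : lift ord0 ord0 = 1); last exact: val_inj.
Qed.

(** * Pulling forms back along endomorphisms *)

Section PullBack.
Variables (K : fieldType) (t : nat).
Hypothesis t5 : (t <= 5)%N.
Local Notation n := (free_nil K 2 t).
Local Notation g := (@nil_gen K 2 t).
Local Notation proj := (@nil_proj K 2 t).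
Local Notation lift := (@nil_lift K 2 t).
Local Notation hmap := (hall_map K).
Implicit Types (B : n -> n -> K) (f : {linear n -> n}).

Definition lie_endo f : Prop := {morph f : x y / lie x y >-> lie x y}.

(** Reduces the Gram data of a pulled-back form to polynomials in the Hall coordinates of the images
    of the generators. *)
Lemma pull_gram f B (u : 'I_2 -> free_lie K 2) :
  lie_endo f -> inv_sym_form B -> (forall i, f (g i) = proj (u i)) ->
  let Q := hall_form (gram1 g B) (gram2 g B) (gram3 g B) in
  let B' := fun x y => B (f x) (f y) in
  [/\ gram1 g B' = gram1 (hmap \o u) Q, gram2 g B' = gram2 (hmap \o u) Q
    & gram3 g B' = gram3 (hmap \o u) Q].
Proof.
move=> fl BP fu Q B'; split; last 1 first.
- apply/matrixP => i j; rewrite !mxE /B' !fl !fu -!nil_proj_lie inv_form_projE //.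
  by rewrite /free_form !hall_map_lie.
- by apply/matrixP => i j; rewrite !mxE /B' !fu inv_form_projE.
- by rewrite /gram2 /B' !fl !fu -!nil_proj_lie inv_form_projE // /free_form !hall_map_lie.
Qed.

(** Column [j] of [P] is the linear part of [x j]. The new h_3 starts with det P times h_3, the new
    h_4, h_5 with det P times the images of h_4, h_5 under [P]; terms of higher degree pair to zero
    there. *)
Lemma hall_gram3 A c A' (x : 'I_2 -> hall_model K) (P : 'M[K]_2) : A'^T = A' ->
  (forall i j : 'I_2, x j i = P i j) ->
  gram3 x (hall_form A c A') = (\det P) ^+ 2 *: (P^T *m A' *m P).
Proof.
move=> As xP; apply/matrixP => i j; rewrite det_mx22 [RHS]mxE !mulmx22 !mxE.
have A10 : A' 1 0 = A' 0 1 by rewrite -[in LHS]As mxE.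
rewrite A10 -!xP /hall_form /lie /= /hall_bracket /=; ring.
Qed.

Lemma hall_gram2 A c (x : 'I_2 -> hall_model K) (P : 'M[K]_2) :
  (forall i j : 'I_2, x j i = P i j) ->
  gram2 x (hall_form A c 0) = (\det P) ^+ 2 * c.
Proof.
move=> xP; rewrite det_mx22 /gram2 -!xP /hall_form !mxE /lie /= /hall_bracket /=; ring.
Qed.

Definition pull_equiv B B' : Prop :=
  exists f, [/\ lie_endo f, bijective f & forall x y, B' x y = B (f x) (f y)].

Lemma pull_equiv_trans B1 B2 B3 :
  pull_equiv B1 B2 -> pull_equiv B2 B3 -> pull_equiv B1 B3.
Proof.
move=> [f [fl fb fE]] [f' [fl' fb' fE']]; exists (f \o f'); split.
- by move=> x y /=; rewrite fl' fl.
- exact: bij_comp.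
- by move=> x y; rewrite fE' fE.
Qed.

(** A bijective isometry and its inverse both preserve kernels, because every second argument is an
    image. *)
Lemma pull_equiv_isomorphic (o1 o2 : sym0_obj K 2 t) :
  pull_equiv o1 o2 -> @isomorphic (Sym0 K 2 t) o1 o2.
Proof.
move=> [f [fl [f' fK f'K] fE]].
have f'lin : linear f' by move=> a x y; rewrite -{1}[x]f'K -{1}[y]f'K -linearP fK.
pose F' : {linear n -> n} :=
  HB.pack_for {linear n -> n} f' (GRing.isLinear.Build K n n *:%R f' f'lin).
have F'l : lie_endo F' by move=> x y /=; rewrite -{1}[x]f'K -{1}[y]f'K -fl fK.
have F'E x y : o1 x y = o2 (F' x) (F' y) by rewrite fE /= !f'K.
have kerf : (f @` form_ker o2 `<=` form_ker o1)%classic.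
  by move=> _ [x kx <-] y; rewrite -[y]f'K -fE kx.
have kerf' : (F' @` form_ker o1 `<=` form_ker o2)%classic.
  by move=> _ [x kx <-] y; rewrite -[y]fK -[f y]/(f y) -F'E kx.
pose G : MEnd o2 o1 := MkMEnd fl fE kerf.
pose G' : MEnd o1 o2 := MkMEnd F'l F'E kerf'.
exists (hom_class G'), (hom_class G).
split; rewrite [LHS]sym0_compE; apply/hom_classP => x /=.
- by rewrite f'K subrr; apply: (inv_form0l (sym0_inv_sym_form (sym0_formP o1))).
- by rewrite fK subrr; apply: (inv_form0l (sym0_inv_sym_form (sym0_formP o2))).
Qed.

(** The representative is taken from the inverse morphism, so that [o2] is the form pulled back, as
    in the formula to be proved. *)
Lemma isomorphic_MEnd (o1 o2 : sym0_obj K 2 t) :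
  @isomorphic (Sym0 K 2 t) o1 o2 ->
  exists f, lie_endo f /\ forall x y, o2 x y = o1 (f x) (f y).
Proof.
move=> [_ [G _]]; exists (mend (hom_repr G)).
by split=> x y; [apply: mend_lie | apply: mend_form].
Qed.

Lemma pull_linear B (P : 'M[K]_2) : (0 < t)%N -> inv_sym_form B -> P \in unitmx ->
  exists B', [/\ pull_equiv B B', inv_sym_form B',
    gram3 g B' = (\det P) ^+ 2 *: (P^T *m gram3 g B *m P)
    & gram3 g B = 0 -> gram2 g B' = (\det P) ^+ 2 * gram2 g B].
Proof.
move=> t0 BP Pu.
pose w (Q : 'M[K]_2) (j : 'I_2) := \sum_i Q i j *: g i.
have [f [fg fl]] := nil_universal (w P).
have [f' [fg' fl']] := nil_universal (w (invmx P)).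
(* Composition of linear substitutions multiplies their matrices, so mutually inverse matrices give
   mutually inverse endomorphisms. *)
have comp (Q R : 'M[K]_2) (h h' : {linear n -> n}) :
    (forall i, h (g i) = w Q i) -> (forall i, h' (g i) = w R i) ->
    lie_endo h -> lie_endo h' -> Q *m R = 1%:M -> cancel h' h.
  move=> hg hg' hl hl' QR.
  have: (h \o h' : {linear n -> n}) =1 (idfun : {linear n -> n}).
    apply: nil_endo_ext => [x y|x y|j] //=; first by rewrite hl' hl.
    rewrite hg' linear_sum; under eq_bigr => k _ do rewrite linearZ /= hg scaler_sumr.
    rewrite exchange_big /= -[RHS]scale1r (bigD1 j) //= [X in _ + X]big1 ?addr0.
      under eq_bigr do rewrite scalerA mulrC; rewrite -scaler_suml; congr (_ *: _).
      by have /matrixP/(_ j j) := QR; rewrite !mxE eqxx.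
    move=> i ij; under eq_bigr do rewrite scalerA mulrC.
    rewrite -scaler_suml; have /matrixP/(_ i j) := QR; rewrite !mxE (negbTE ij) => ->.
    by rewrite scale0r.
  by move=> E x; apply: E.
have fb : bijective f.
  by exists f'; [apply: comp fg' fg fl' fl _ | apply: comp fg fg' fl fl' _];
    rewrite ?mulVmx ?mulmxV.
pose u j := \sum_i P i j *: free_gen K i.
have fu i : f (g i) = proj (u i).
  by rewrite fg /u linear_sum; apply: eq_bigr => k _; rewrite linearZ.
have uP (i j : 'I_2) : (hmap \o u) j i = P i j.
  rewrite /= /u !big_ord_recl big_ord0 addr0 hall_mapD !hall_mapZ.
  rewrite !hall_map_gen /hall_model_gen.
  rewrite (_ : ord0 = 0) // (_ : fintype.lift 0 0 = 1); last exact: val_inj.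
  by elim/ord2_ind: i => /=; ring.
exists (fun x y => B (f x) (f y)); have [_ E2 E3] := pull_gram fl BP fu.
split.
- by exists f.
- exact: inv_sym_form_pull.
- by rewrite E3 (hall_gram3 _ _ (gram3_sym _ BP) uP).
- by move=> g30; rewrite E2 g30 (hall_gram2 _ _ uP).
Qed.

(** [s i] lists the Hall coefficients of the correction w_i in x_i + w_i. The linear part is the
    identity matrix, hence [gram3] stays. *)
Lemma pull_unipotent B (s : 'I_2 -> nat -> K) : inv_sym_form B ->
  (forall i, s i 0%N = 0 /\ s i 1%N = 0) ->
  exists B' (x : 'I_2 -> hall_model K), [/\ pull_equiv B B', inv_sym_form B',
    forall i k, (k < 14)%N -> x i k = (k == i)%:R + s i k &
    let Q := hall_form (gram1 g B) (gram2 g B) (gram3 g B) in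
    [/\ gram1 g B' = gram1 x Q, gram2 g B' = gram2 x Q & gram3 g B' = gram3 g B]].
Proof.
move=> BP s01.
pose c (i : 'I_2) : free_lie K 2 := hall_comb (free_gen K 0) (free_gen K 1) (s i).
pose u i := free_gen K i + c i.
have [f [fg fl]] := nil_universal (proj \o u).
have ux i k : (k < 14)%N -> hmap (u i) k = (k == i)%:R + s i k.
  by move=> k14; rewrite hall_mapD hall_map_gen hall_map_comb.
exists (fun x y => B (f x) (f y)), (hmap \o u); split=> //.
- exists f; split=> //; apply: nil_unipotent => // i.
  rewrite fg /= /u linearD addrC addKr; apply: lie_morph_lcs; first exact: nil_proj_lie.
  by have [s0 s1] := s01 i; apply: hall_comb_lcs2.
- exact: inv_sym_form_pull.
- have [-> -> ->] := pull_gram fl BP fg; split=> //.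
  rewrite (hall_gram3 _ _ (P := 1%:M)) ?gram3_sym //.
    by rewrite det1 expr1n scale1r trmx1 mul1mx mulmx1.
  move=> i j; rewrite /= ux; last by elim/ord2_ind: i.
  rewrite mxE val_eqE; have [s0 s1] := s01 j.
  by elim/ord2_ind: i; rewrite /= ?s0 ?s1 addr0.
Qed.

End PullBack.

Lemma mx22_sym_eq (R : Type) (A B : 'M[R]_2) : A^T = A -> B^T = B ->
  A 0 0 = B 0 0 -> A 0 1 = B 0 1 -> A 1 1 = B 1 1 -> A = B.
Proof.
move=> As Bs E00 E01 E11; apply/matrixP => i j.
elim/ord2_ind: i; elim/ord2_ind: j => //.
by rewrite -As -Bs !mxE.
Qed.

(** * Normalizing the Gram data and the isomorphism criteria *)

Section Isomorphisms.
Variable K : fieldType.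
Hypothesis K2 : 2%:R != 0 :> K.
Local Notation n t := (free_nil K 2 t).
Local Notation g t := (@nil_gen K 2 t).

Definition pair_coord (p q : nat) (a b : K) (k : nat) : K :=
  if k == p then a else if k == q then b else 0.

Lemma pull_gram1_23 (B : n 3 -> n 3 -> K) (T : 'M[K]_2) : inv_sym_form B ->
  gram2 (g 3) B != 0 -> T^T = T ->
  exists B', [/\ pull_equiv B B', inv_sym_form B', gram1 (g 3) B' = T
    & gram2 (g 3) B' = gram2 (g 3) B].
Proof.
move=> BP; set c := gram2 _ B => c0 Ts; set A := gram1 (g 3) B.
(* With corrections in [n^3], the diagonal entries of [gram1] change by 2c times the h_5-coefficient
   of the first correction and by -2c times the h_4-coefficient of the second; the off-diagonal
   entry changes by c times the h_5-coefficient of the second. *)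
pose s (i : 'I_2) := if i == 0 then pair_coord 3 4 0 ((T 0 0 - A 0 0) / (2 * c))
  else pair_coord 3 4 ((A 1 1 - T 1 1) / (2 * c)) ((T 0 1 - A 0 1) / c).
have [|B' [x [eB B'P xE]]] := @pull_unipotent _ 3 isT _ s BP.
  by elim/ord2_ind.
rewrite /= gram3_eq0 // -/A -/c => -[E1 E2 _]; exists B'; split=> //; clearbody A.
- apply: mx22_sym_eq => //; first exact: gram1_sym;
    by rewrite E1 mxE /hall_form !mxE !xE //= /s /pair_coord /=; field; rewrite ?K2 ?c0.
- rewrite E2 (hall_gram2 _ _ (P := 1%:M)) ?det1 ?expr1n ?mul1r //.
  by elim/ord2_ind; elim/ord2_ind; rewrite xE // mxE /s /pair_coord /= addr0.
Qed.

Lemma pull_gram2_25 (B : n 5 -> n 5 -> K) (c : K) : inv_sym_form B ->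
  gram3 (g 5) B != 0 ->
  exists B', [/\ pull_equiv B B', inv_sym_form B', gram2 (g 5) B' = c
    & gram3 (g 5) B' = gram3 (g 5) B].
Proof.
move=> BP; set D := gram3 _ B => D0; set c0 := gram2 (g 5) B.
(* For w_1 = a h_4 + b h_5 and w_2 = a' h_4 + b' h_5 the parenthesis is B(h_5,w_1) - B(h_4,w_2), the
   first-order change of B(h_3,h_3); a nonzero entry of [D] lets it take any value. *)
have [a [b [a' [b' Eab]]]] : exists a b a' b',
    c0 + 2 * (D 0 1 * a + D 1 1 * b - D 0 0 * a' - D 0 1 * b') = c.
  move: D0; rewrite mx2_eq0 ?gram3_sym //.
  have [-> |d0 _] := eqVneq (D 0 0) 0; last first.
    by exists 0, 0, ((c0 - c) / (2 * D 0 0)), 0; field; rewrite ?K2 ?d0.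
  have [-> /= f0|e0 _] := eqVneq (D 0 1) 0; last first.
    by exists ((c - c0) / (2 * D 0 1)), 0, 0, 0; field; rewrite ?K2 ?e0.
  by exists 0, ((c - c0) / (2 * D 1 1)), 0, 0; field; rewrite ?K2 ?f0.
pose s (i : 'I_2) := if i == 0 then pair_coord 3 4 a b else pair_coord 3 4 a' b'.
have [|B' [x [eB B'P xE]]] := @pull_unipotent _ 5 isT _ s BP.
  by elim/ord2_ind.
move=> /= -[_ E2 E3]; exists B'; split=> //.
rewrite E2 -Eab -/D -/c0 /gram2 /hall_form /lie /= /hall_bracket /= !xE //=.
rewrite /s /pair_coord /=; ring.
Qed.

Lemma pull_gram1_25 (B : n 5 -> n 5 -> K) (T : 'M[K]_2) : inv_sym_form B ->
  gram3 (g 5) B != 0 -> T^T = T ->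
  exists B', [/\ pull_equiv B B', inv_sym_form B', gram1 (g 5) B' = T,
    gram2 (g 5) B' = gram2 (g 5) B & gram3 (g 5) B' = gram3 (g 5) B].
Proof.
move=> BP; set D := gram3 _ B => D0 Ts; set c := gram2 (g 5) B.
set A := gram1 (g 5) B.
(* [p] and [q] are the pairings of the first and the second generator with a correction of degree 5.
   Such a correction does not change h_3 and so leaves [gram2] alone. *)
pose p (v : nat -> K) :=
  D 0 0 * (v 10%N - v 9%N) + D 0 1 * (v 12%N - v 11%N) - D 1 1 * v 13%N.
pose q (v : nat -> K) := D 0 0 * v 8%N + D 0 1 * v 10%N + D 1 1 * v 12%N.
(* Since [D] is nonzero, [p] and [q] are linearly independent. *)
have dual a b : exists v, [/\ forall k, (k < 8)%N -> v k = 0, p v = a & q v = b].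
  have low i j x y k : (8 <= i)%N -> (8 <= j)%N -> (k < 8)%N -> pair_coord i j x y k = 0.
    move=> i8 j8 k8; rewrite /pair_coord.
    by rewrite !ltn_eqF // ?(leq_trans k8 i8) // (leq_trans k8 j8).
  move: D0; rewrite mx2_eq0 ?gram3_sym // /p /q /pair_coord.
  have [-> |d0 _] := eqVneq (D 0 0) 0; last first.
    exists (pair_coord 8 9 (b / D 0 0) (- a / D 0 0)).
    by split=> [k||]; [apply: low | rewrite /pair_coord /=; field ..].
  have [-> /= f0|e0 _] := eqVneq (D 0 1) 0; last first.
    exists (pair_coord 10 11 (b / D 0 1) (- a / D 0 1)).
    by split=> [k||]; [apply: low | rewrite /pair_coord /=; field ..].
  exists (pair_coord 12 13 (b / D 1 1) (- a / D 1 1)).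
  by split=> [k||]; [apply: low | rewrite /pair_coord /=; field ..].
have [v0 [v0l p0 q0]] := dual ((T 0 0 - A 0 0) / 2) 0.
have [v1 [v1l p1 q1]] := dual (T 0 1 - A 0 1) ((T 1 1 - A 1 1) / 2).
pose s (i : 'I_2) := if i == 0 then v0 else v1.
have [|B' [x [eB B'P xE]]] := @pull_unipotent _ 5 isT _ s BP.
  by elim/ord2_ind; rewrite /s /= ?v0l ?v1l.
move=> /= -[E1 E2 E3].
have z0 := (v0l 0 isT, v0l 1 isT, v0l 2 isT, v0l 3 isT,
  v0l 4 isT, v0l 5 isT, v0l 6 isT, v0l 7 isT).
have z1 := (v1l 0 isT, v1l 1 isT, v1l 2 isT, v1l 3 isT,
  v1l 4 isT, v1l 5 isT, v1l 6 isT, v1l 7 isT).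
exists B'; split=> //.
- apply: mx22_sym_eq => //; first exact: gram1_sym.
  + rewrite E1 mxE -/D -/c -/A /hall_form !xE // /s /= ?z0.
    transitivity (A 0 0 + 2 * p v0); first by rewrite /p; ring.
    by rewrite p0; field.
  + rewrite E1 mxE -/D -/c -/A /hall_form !xE // /s /= ?z0 ?z1.
    transitivity (A 0 1 + p v1 + q v0); first by rewrite /p /q; ring.
    by rewrite p1 q0; ring.
  + rewrite E1 mxE -/D -/c -/A /hall_form !xE // /s /= ?z1.
    transitivity (A 1 1 + 2 * q v1); first by rewrite /q; ring.
    by rewrite q1; field.
- rewrite E2 -/D -/c -/A /gram2 /hall_form /lie /= /hall_bracket /= !xE // /s /=.
  by rewrite ?z0 ?z1; ring.
Qed.

Lemma inv_sym_form_eq t (B B' : n t -> n t -> K) : (t <= 5)%N ->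
  inv_sym_form B -> inv_sym_form B' -> gram1 (g t) B = gram1 (g t) B' ->
  gram2 (g t) B = gram2 (g t) B' -> gram3 (g t) B = gram3 (g t) B' -> B = B'.
Proof.
by move=> t5 BP BP' E1 E2 E3; rewrite (nil_formE t5 BP) (nil_formE t5 BP') E1 E2 E3.
Qed.

Lemma isomorphic_23 (A1 A2 : 'M[K]_2) (gamma delta : K)
    (o1 : is_sym0 (B23 A1 gamma)) (o2 : is_sym0 (B23 A2 delta)) :
  A1^T = A1 -> A2^T = A2 -> gamma != 0 -> delta != 0 ->
  (@isomorphic (Sym0 K 2 3) (Sym0Obj o1) (Sym0Obj o2) <->
   exists k : K, delta / gamma = k ^+ 2).
Proof.
move=> As1 As2 c0 d0.
have kill A c u v : lcs (free_lie K 2) 4 u -> free_form A c 0 u v = 0.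
  exact: free_form_lcs4.
have P1 := sym0_inv_sym_form o1; have P2 := sym0_inv_sym_form o2.
have G1 : gram1 (g 3) (B23 A1 gamma) = A1 by rewrite B23E (nil_form_gram1 (kill _ _)).
have G2 : gram1 (g 3) (B23 A2 delta) = A2 by rewrite B23E (nil_form_gram1 (kill _ _)).
have H1 : gram2 (g 3) (B23 A1 gamma) = gamma by rewrite B23E (nil_form_gram2 (kill _ _)).
have H2 : gram2 (g 3) (B23 A2 delta) = delta by rewrite B23E (nil_form_gram2 (kill _ _)).
split.
  move=> /isomorphic_MEnd[f [fl fE]]; rewrite /= in fE.
  have fu i : f (g 3 i) = nil_proj 3 (nil_lift (f (g 3 i))) by rewrite nil_liftK.
  have [_ E _] := @pull_gram _ 3 isT _ _ _ fl P1 fu.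
  pose P : 'M[K]_2 := \matrix_(i, j) hall_map K (nil_lift (f (g 3 j))) i.
  (* [P] is the linear part of the endomorphism; as [gram3] vanishes, [gram2] is multiplied by its
     squared determinant. *)
  exists (\det P).
  rewrite -H2 (_ : B23 A2 delta = fun x y => B23 A1 gamma (f x) (f y)); last first.
    by apply/funext => x; apply/funext => y; apply: fE.
  by rewrite E gram3_eq0 // (hall_gram2 _ _ (P := P)) ?H1 ?mulfK // => i j; rewrite mxE.
move=> [k dk]; have dE : delta = k ^+ 2 * gamma by rewrite -dk divfK.
have k0 : k != 0.
  by apply: contraNneq d0 => k0; rewrite dE k0 expr0n mul0r.
(* The diagonal matrix with entries k and 1 has determinant k; [gram1] is corrected afterwards. *)
pose P : 'M[K]_2 := \matrix_(i, j) if i == j then if i == 0 then k else 1 else 0.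
have detP : \det P = k by rewrite det_mx22 !mxE /=; ring.
have Pu : P \in unitmx by rewrite unitmxE detP unitfE.
have [B1 [e1 B1P _ E1]] := @pull_linear _ 3 isT _ _ isT P1 Pu.
have H : gram2 (g 3) B1 = delta by rewrite E1 ?gram3_eq0 // detP H1 dE.
have [|B2 [e2 B2P E2 F2]] := pull_gram1_23 B1P _ As2; first by rewrite H.
apply: pull_equiv_isomorphic; rewrite /=.
suff -> : B23 A2 delta = B2 by apply: pull_equiv_trans e1 e2.
apply: inv_sym_form_eq => //; rewrite ?gram3_eq0 ?E2 ?F2 ?H //.
Qed.

Lemma isomorphic_25 (A1 A2 B1 B2 : 'M[K]_2) (gamma delta : K)
    (o1 : is_sym0 (B25 A1 gamma A2)) (o2 : is_sym0 (B25 B1 delta B2)) :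
  A1^T = A1 -> A2^T = A2 -> (1 <= \rank A2)%N ->
  B1^T = B1 -> B2^T = B2 -> (1 <= \rank B2)%N ->
  (@isomorphic (Sym0 K 2 5) (Sym0Obj o1) (Sym0Obj o2) <->
   exists P : 'M[K]_2, P \in unitmx /\ B2 = (\det P) ^+ 2 *: (P^T *m A2 *m P)).
Proof.
move=> As1 As2 _ Bs1 Bs2; rewrite lt0n mxrank_eq0 => B20.
have kill A c A' u v : lcs (free_lie K 2) 6 u -> free_form A c A' u v = 0.
  exact: free_form_lcs6.
have P1 := sym0_inv_sym_form o1; have P2 := sym0_inv_sym_form o2.
have F1 : gram1 (g 5) (B25 B1 delta B2) = B1.
  by rewrite B25E (nil_form_gram1 (kill _ _ _)).
have F2 : gram2 (g 5) (B25 B1 delta B2) = delta.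
  by rewrite B25E (nil_form_gram2 (kill _ _ _)).
have F3 : gram3 (g 5) (B25 B1 delta B2) = B2.
  by rewrite B25E (nil_form_gram3 (kill _ _ _)).
have E3 : gram3 (g 5) (B25 A1 gamma A2) = A2.
  by rewrite B25E (nil_form_gram3 (kill _ _ _)).
split.
  move=> /isomorphic_MEnd[f [fl fE]]; rewrite /= in fE.
  have fu i : f (g 5 i) = nil_proj 5 (nil_lift (f (g 5 i))) by rewrite nil_liftK.
  have [_ _ E] := @pull_gram _ 5 isT _ _ _ fl P1 fu.
  pose P : 'M[K]_2 := \matrix_(i, j) hall_map K (nil_lift (f (g 5 j))) i.
  have BE : B2 = (\det P) ^+ 2 *: (P^T *m A2 *m P).
    rewrite -F3 (_ : B25 B1 delta B2 = fun x y => B25 A1 gamma A2 (f x) (f y)).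
      by rewrite E (hall_gram3 _ _ (P := P)) ?E3 // => i j; rewrite mxE.
    by apply/funext => x; apply/funext => y; apply: fE.
  (* A singular linear part would give [B2 = 0], against the rank condition. *)
  exists P; split=> //; rewrite unitmxE unitfE.
  by apply: contraNneq B20 => P0; rewrite BE P0 expr0n scale0r.
move=> [P [Pu BE]].
(* Three successive changes adjust [gram3], [gram2] and [gram1], each keeping what has already been
   reached. *)
have [C [e CP C3 _]] := @pull_linear _ 5 isT _ _ isT P1 Pu.
rewrite E3 -BE in C3.
have [|C' [e' CP' C2' C3']] := pull_gram2_25 delta CP; first by rewrite C3.
have [|C'' [e'' CP'' C1'' C2'' C3'']] := pull_gram1_25 CP' _ Bs1.
  by rewrite C3' C3.
apply: pull_equiv_isomorphic; rewrite /=.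
suff -> : B25 B1 delta B2 = C''.
  by apply: pull_equiv_trans e''; apply: pull_equiv_trans e'.
by apply: inv_sym_form_eq => //; rewrite ?F1 ?F2 ?F3 ?C1'' ?C2'' ?C3'' ?C2' ?C3' ?C3.
Qed.

End Isomorphisms.

Theorem theorem5p2 (K : fieldType) (charK : [pchar K] =i pred0) :
  (obj (Sym0 K 2 2) -> False) /\
  (obj (Sym0 K 2 4) -> False) /\
  ((forall B : free_nil K 2 3 -> free_nil K 2 3 -> K,
      is_sym0 B <->
      exists (A : 'M[K]_2) (gamma : K),
        A^T = A /\ gamma != 0 /\ B = B23 A gamma) /\
   (forall (A1 A2 : 'M[K]_2) (gamma delta : K)
       (o1 : is_sym0 (B23 A1 gamma)) (o2 : is_sym0 (B23 A2 delta)),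
      A1^T = A1 -> A2^T = A2 -> gamma != 0 -> delta != 0 ->
      (@isomorphic (Sym0 K 2 3) (Sym0Obj o1) (Sym0Obj o2) <->
       exists k : K, delta / gamma = k ^+ 2))) /\
  ((forall B : free_nil K 2 5 -> free_nil K 2 5 -> K,
      is_sym0 B <->
      exists (A1 : 'M[K]_2) (gamma : K) (A2 : 'M[K]_2),
        A1^T = A1 /\ A2^T = A2 /\ (1 <= \rank A2)%N /\ B = B25 A1 gamma A2) /\
   (forall (A1 A2 B1 B2 : 'M[K]_2) (gamma delta : K)
       (o1 : is_sym0 (B25 A1 gamma A2)) (o2 : is_sym0 (B25 B1 delta B2)),
      A1^T = A1 -> A2^T = A2 -> (1 <= \rank A2)%N ->
      B1^T = B1 -> B2^T = B2 -> (1 <= \rank B2)%N ->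
      (@isomorphic (Sym0 K 2 5) (Sym0Obj o1) (Sym0Obj o2) <->
       exists P : 'M[K]_2,
         P \in unitmx /\ B2 = (\det P) ^+ 2 *: (P^T *m A2 *m P)))).
Proof.
have K2 : 2%:R != 0 :> K by rewrite ((pcharf0P K).1 charK).
split; first by move=> [B B0]; apply: no_sym0_22 B0.
split; first by move=> [B B0]; apply: no_sym0_24 B0.
split; split; [exact: sym0_23P | exact: isomorphic_23 | exact: sym0_25P |].
exact: isomorphic_25.
Qed.
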